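(* Let $k\ge1$ be an integer and let $\bar T\subset\mathbb{R}^3$ be the tetrahedron with vertices $0,\ \mathbf{e}_1+\mathbf{e}_2,\ \mathbf{e}_2,\ \mathbf{e}_3$. Then there is a constant $C>0$, independent of $\bar{\mathbf{u}}$, such that for all $\bar{\mathbf{u}}=(\bar u_1,\bar u_2,\bar u_3)^T\in\mathbf{H}^1(\bar T)=(H^1(\bar T))^3$, $$\|(\bar I_k^{\mathrm{BDM}}\bar{\mathbf{u}})_i\|_{0,\bar T}\le C\Big(\|\bar u_i\|_{1,\bar T}+\sum_{j\in\{1,2,3\}\setminus\{i\}}\Big\|\frac{\partial\bar u_j}{\partial\bar x_j}\Big\|_{0,\bar T}\Big),\qquad i=1,2,3.$$
   Context: $\mathbf{e}_1,\mathbf{e}_2,\mathbf{e}_3$ are the Cartesian unit vectors. $\|\cdot\|_{0,\bar T}$ and $\|\cdot\|_{1,\bar T}$ are the $L^2(\bar T)$ and $H^1(\bar T)$ norms, and $(\cdot)_i$ denotes the $i$-th component. Brezzi-Douglas-Marini interpolation on $\bar T$: let $F_1,\dots,F_4$ be the faces of $\bar T$ with outward unit normals $\mathbf{n}_1,\dots,\mathbf{n}_4$. $P_k$ denotes polynomials of total degree at most $k$, $\mathbf{P}_k(\bar T)=(P_k(\bar T))^3$, $\mathbf{S}_k(\bar T)=\{\mathbf{p}\in\mathbf{P}_k(\bar T):\mathbf{p}\cdot\mathbf{x}\equiv0\}$, $\mathbf{N}_k(\bar T)=\mathbf{P}_{k-1}(\bar T)+\mathbf{S}_k(\bar T)$.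 For $k\ge1$, $\bar I_k^{\mathrm{BDM}}\mathbf{v}\in\mathbf{P}_k(\bar T)$ is the unique element with $$\int_{F_i}(\bar I_k^{\mathrm{BDM}}\mathbf{v})\cdot\mathbf{n}_i\,z=\int_{F_i}\mathbf{v}\cdot\mathbf{n}_i\,z\quad\forall z\in P_k(F_i),\ i=1,\dots,4,$$ and, if $k\ge2$, $$\int_{\bar T}(\bar I_k^{\mathrm{BDM}}\mathbf{v})\cdot\mathbf{z}=\int_{\bar T}\mathbf{v}\cdot\mathbf{z}\quad\forall\mathbf{z}\in\mathbf{N}_{k-1}(\bar T).$$ *)

(* Defs.v *)
From HB Require Import structures.
From mathcomp Require Import all_boot all_order all_algebra.
(* The notations of mpoly clash with those of MathComp-Analysis. *)
From mathcomp Require Import -(notations) mpoly.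
From mathcomp Require Import all_classical all_reals all_analysis.

Set Implicit Arguments.
Unset Strict Implicit.
Unset Printing Implicit Defensive.

Import Order.TTheory GRing.Theory Num.Theory numFieldNormedType.Exports.

Local Open Scope classical_set_scope.
Local Open Scope ring_scope.

Notation poly3 R := (mpoly.mpoly 3 R).

Section Space.
Context (R : realType).

(* Only the product topology of R^3 and its linear structure are used, so the
   fact that the library norm on this product is the max norm plays no role. *)
Definition R3 : Type := (R * R * R)%type.

Definition coord3 (x : R3) (i : 'I_3) : R := tnth [tuple x.1.1; x.1.2; x.2] i.

Definition dot (x y : R3) : R := \sum_(i < 3) coord3 x i * coord3 y i.

Definition unit_vec (i : 'I_3) : R3 :=
  ((i == 0)%:R, (i == 1)%:R, (i == 2)%:R).

Definition leb2 : {measure set (measurableTypeR R * measurableTypeR R) -> \bar R} :=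
  (@lebesgue_measure R \x @lebesgue_measure R)%E.

Definition leb3 :
    {measure set (measurableTypeR R * measurableTypeR R * measurableTypeR R)
       -> \bar R} :=
  ((@lebesgue_measure R \x @lebesgue_measure R) \x @lebesgue_measure R)%E.

End Space.

Section Tetrahedron.
Context (R : realType).

Definition vtx (i : 'I_4) : R3 R :=
  tnth [tuple (0, 0, 0); (1, 1, 0); (0, 1, 0); (0, 0, 1)] i.

Definition tet : set (R3 R) :=
  [set x | exists l : 'I_4 -> R,
     [/\ forall i, 0 <= l i, \sum_(i < 4) l i = 1 &
         x = \sum_(i < 4) l i *: vtx i]].

(* The face number i is the one opposite to the vertex number i. *)
Definition face_vtx (i : 'I_4) (j : 'I_3) : R3 R := vtx (lift i j).

Definition outward_unit_normal (i : 'I_4) (n : R3 R) : Prop :=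
  [/\ dot n n = 1,
      forall j l, dot n (face_vtx i j - face_vtx i l) = 0 &
      forall j, dot n (vtx i - face_vtx i j) < 0].

Definition ref_tri : set (R * R) :=
  [set s | [/\ 0 <= s.1, 0 <= s.2 & s.1 + s.2 <= 1]].

Definition face_par (i : 'I_4) (s : R * R) : R3 R :=
  face_vtx i 0 + s.1 *: (face_vtx i 1 - face_vtx i 0)
               + s.2 *: (face_vtx i 2 - face_vtx i 0).

(* Square root of the Gram determinant of face_par, i.e. twice the area of the
   face. *)
Definition face_jac (i : 'I_4) : R :=
  let p := face_vtx i 1 - face_vtx i 0 in
  let q := face_vtx i 2 - face_vtx i 0 in
  Num.sqrt (dot p p * dot q q - dot p q ^+ 2).

Definition face_int (i : 'I_4) (f : R3 R -> R) : R :=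
  face_jac i * \int[leb2 R]_(s in ref_tri) f (face_par i s).

Definition tet_int (f : R3 R -> R) : R := \int[leb3 R]_(x in tet) f x.

End Tetrahedron.

Section Sobolev.
Context (R : realType).

(* Functions on the tetrahedron (resp. a face) are represented by total
   functions on R^3; the values taken elsewhere are irrelevant. *)
Definition L2_tet (f : R3 R -> R) : Prop :=
  (f \_ (@tet R)) \in Lfun (leb3 R) 2%:E.

Definition L2_face (i : 'I_4) (f : R3 R -> R) : Prop :=
  ((f \o face_par i) \_ (@ref_tri R)) \in Lfun (leb2 R) 2%:E.

Definition L2norm (f : R3 R -> R) : R :=
  fine ('N[leb3 R]_2%:E [EFin \o (f \_ (@tet R))])%E.

Definition pd (i : 'I_3) (f : R3 R -> R) : R3 R -> R :=
  fun x => 'D_(unit_vec R i) f x.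

Fixpoint Ck (n : nat) (f : R3 R -> R) : Prop :=
  continuous f /\
  if n is m.+1 then
    forall i, (forall x, derivable f x (unit_vec R i)) /\ Ck m (pd i f)
  else True.

Definition smooth (f : R3 R -> R) : Prop := forall n, Ck n f.

Definition test_fun (f : R3 R -> R) : Prop :=
  smooth f /\
  exists K : set (R3 R),
    [/\ compact K, K `<=` (@tet R)° & forall x, ~ K x -> f x = 0].

Definition weak_pd (i : 'I_3) (u g : R3 R -> R) : Prop :=
  forall phi, test_fun phi ->
    tet_int (fun x => u x * pd i phi x) = - tet_int (fun x => g x * phi x).

(* An element of H^1, given by representatives of the function and of its weak
   partial derivatives (which are unique almost everywhere). *)
Record H1space : Type := MkH1 {
  H1val :> R3 R -> R;
  wpd : 'I_3 -> R3 R -> R;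
  H1val_L2 : L2_tet H1val;
  wpd_L2 : forall i, L2_tet (wpd i);
  wpdP : forall i, weak_pd i H1val (wpd i) }.

Definition H1norm_of (u : R3 R -> R) (g : 'I_3 -> R3 R -> R) : R :=
  Num.sqrt (L2norm u ^+ 2 + \sum_(i < 3) L2norm (g i) ^+ 2).

Definition H1norm (u : H1space) : R := H1norm_of u (wpd u).

(* g is the trace of u on the face i: the limit in L^2 of the face of the
   restrictions of functions smooth up to the boundary which tend to u
   in H^1. *)
Definition is_trace (i : 'I_4) (u : H1space) (g : R3 R -> R) : Prop :=
  L2_face i g /\
  exists phi : nat -> R3 R -> R,
    [/\ forall m, smooth (phi m),
        (fun m => H1norm_of (fun x => phi m x - u x)
                    (fun j x => pd j (phi m) x - wpd u j x)) @ \oo --> (0 : R) &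
        (fun m => face_int i (fun x => (phi m x - g x) ^+ 2)) @ \oo --> (0 : R)].

End Sobolev.

Section BDM.
Context (R : realType).

Definition peval (p : poly3 R) (x : R3 R) : R := meval (coord3 x) p.

(* msize is one more than the total degree, and 0 for the zero polynomial. *)
Definition polP (k : nat) (p : poly3 R) : Prop := (msize p <= k.+1)%N.

Definition polS (k : nat) (p : 'I_3 -> poly3 R) : Prop :=
  (forall i, polP k (p i)) /\
  \sum_(i < 3) p i * mpolyX R (mnm1 i) = 0.

(* For k >= 1 only. *)
Definition polN (k : nat) (z : 'I_3 -> poly3 R) : Prop :=
  exists p q : 'I_3 -> poly3 R,
    [/\ forall i, polP k.-1 (p i), polS k q & forall i, z i = p i + q i].

(* w is the Brezzi-Douglas-Marini interpolant of u; P_k of a face is the set of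
   restrictions to it of the polynomials of P_k in three variables. *)
Definition is_BDM (k : nat) (u : 'I_3 -> H1space R) (w : 'I_3 -> poly3 R) : Prop :=
  [/\ forall j, polP k (w j),
      exists g : 'I_4 -> 'I_3 -> R3 R -> R,
        (forall i j, is_trace i (u j) (g i j)) /\
        forall i n z, outward_unit_normal i n -> polP k z ->
          face_int i (fun x =>
            (\sum_(j < 3) peval (w j) x * coord3 n j) * peval z x) =
          face_int i (fun x =>
            (\sum_(j < 3) g i j x * coord3 n j) * peval z x) &
      (2 <= k)%N -> forall z, polN k.-1 z ->
        tet_int (fun x => \sum_(j < 3) peval (w j) x * peval (z j) x) =
        tet_int (fun x => \sum_(j < 3) u j x * peval (z j) x)].

End BDM.

(* Main.v *)
(* The idea is duality. The degrees of freedom separate P_k^3, so every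
   coefficient of the component i of the interpolant w is a combination Lambda
   of degrees of freedom, given by polynomials z_F on the faces and z on the
   tetrahedron, and Lambda(w) = Lambda(u). Write Lambda(u) as the sum of the
   contributions of u_1, u_2 and u_3.

   The contribution of u_i is bounded by its H^1 norm: by the divergence theorem
   for the field u z_F (x - v_F), with v_F the vertex opposite to the face F, the
   integral over F of u z_F is an integral over the tetrahedron of terms linear
   in u and in its gradient. This identity passes from smooth functions to H^1
   functions and their traces, and it gives integration by parts in each
   direction, since the area normals satisfy
   sum_F (n_F)_j (x - v_F) = e_j.

   The contribution of u_j with j <> i vanishes when u_j is a polynomial of P_k
   independent of x_j, as Lambda only sees the component i of P_k^3. Lines
   parallel to e_j cross the tetrahedron from one face to another, so that the
   data z_F and z_j can be replaced by a single polynomial zeta with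
   d_j zeta = - z_j, and the contribution of u_j is the integral of
   zeta d_j u_j. *)

Require Import Defs.
From HB Require Import structures.
From mathcomp Require Import all_boot all_order all_algebra.
From mathcomp Require Import -(notations) mpoly.
From mathcomp Require Import all_classical all_reals all_analysis.
From mathcomp Require Import measurable_realfun.
From mathcomp Require Import ring lra.

Set Implicit Arguments.
Unset Strict Implicit.
Unset Printing Implicit Defensive.

Import Order.TTheory GRing.Theory Num.Theory numFieldNormedType.Exports.

Local Open Scope classical_set_scope.
Local Open Scope ring_scope.

(** * Measure-preserving maps and measurability *)

Section MeasurePreserving.
Context (R : realType).
Notation mR := (measurableTypeR R).
Notation lam := (@lebesgue_measure R).

(** Each [e_j] is the direction of an edge of this tetrahedron. The two faces containing that edge
    have normals orthogonal to [e_j], so that only the two faces opposite to its end points enter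
    the contribution of [u_j], and each of them is the graph of an affine function of the other two
    coordinates. This is what makes it possible to absorb all the data for [u_j] in one polynomial.
    The degrees of freedom separate [P_k^3] for the following reason. If they all vanish on [w], the
    divergence of [w] vanishes, since it can serve as test data against itself. Then [w] is
    orthogonal to the gradients of [P_k], and Euler's identity completes these to all fields of
    degree less than [k]. The quotients of combinations of the components of [w] by barycentric
    coordinates are such fields. The interpolant is never constructed: its defining equations are
    tested against data fixed once for each coefficient, and its norm is bounded through its
    coefficients, whence a constant independent of the field. *)

Definition preserves d (T : measurableType d) (m : set T -> \bar R)
    (f : T -> T) : Prop :=
  measurable_fun setT f /\ forall X, measurable X -> m (f @^-1` X) = m X.

Lemma preserves_comp d (T : measurableType d) (m : set T -> \bar R) f g :
  preserves m f -> preserves m g -> preserves m (f \o g).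
Proof.
move=> [mf pf] [mg pg]; split; first exact: measurableT_comp.
move=> X mX; rewrite comp_preimage pg; first exact: pf.
by rewrite -[_ @^-1` _]setTI; exact: mf.
Qed.

Lemma preserves_integral d (T : measurableType d)
    (m : {measure set T -> \bar R}) f (D : set T) (h : T -> R) :
  preserves m f -> measurable D -> measurable_fun setT h ->
  m.-integrable (f @^-1` D) (EFin \o (h \o f)) ->
  \int[m]_(x in D) h x = \int[m]_(x in f @^-1` D) h (f x).
Proof.
move=> [mf pf] mD mh ih; rewrite /Rintegral; congr fine.
rewrite (@eq_measure_integral _ _ _ D (pushforward m f)); last first.
  by move=> A mA _; exact/esym/pf.
by rewrite integral_pushforward//; exact/measurable_EFinP.
Qed.

(** Lebesgue measure is determined by its values on half-open intervals, so the pushforward only has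
    to be tested there. *)
Lemma lam_preserves (f : mR -> mR) : measurable_fun setT f ->
  (forall a b : R, a < b -> lam (f @^-1` `]a, b]) = (b - a)%:E) ->
  preserves lam f.
Proof.
move=> mf fE; split => // X mX; apply/esym.
have -> : lam (f @^-1` X) = pushforward lam f X by [].
pose hf := isMeasurableFun.Build _ _ _ _ _ mf.
pose pf : {mfun mR >-> mR} := MeasurableFun.Pack (MeasurableFun.Class hf).
apply: (@lebesgue_measure_unique R (pushforward lam pf)) => //.
move=> _ [[a b] _ <-] /=; rewrite /pushforward /= lebesgue_measure_itv /= lte_fin.
case: ifPn => [ab|]; first by rewrite fE// EFinB.
rewrite -leNgt => ba; have -> : f @^-1` `]a, b] = set0.
  apply/seteqP; split=> // x /=; rewrite in_itv /= => /andP[/lt_le_trans h1 /h1].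
  by rewrite ltNge ba.
by rewrite measure0.
Qed.

Lemma preserves_shift (a : R) : preserves lam (fun x : mR => a + x).
Proof.
apply: lam_preserves; first exact: measurable_funD.
move=> c d cd; have -> : (fun x : mR => a + x) @^-1` `]c, d] = `]c - a, d - a]%classic.
  by apply/seteqP; split=> x /=; rewrite !in_itv /=; lra.
by rewrite lebesgue_measure_itv /= lte_fin ifT ?EFinB -?EFinB; [congr EFin|]; lra.
Qed.

Lemma preserves_reflect (a : R) : preserves lam (fun x : mR => a - x).
Proof.
apply: lam_preserves; first exact: measurable_funB.
move=> c d cd; have -> : (fun x : mR => a - x) @^-1` `]c, d] = `[a - d, a - c[%classic.
  by apply/seteqP; split=> x /=; rewrite !in_itv /=; lra.
by rewrite lebesgue_measure_itv /= lte_fin ifT ?EFinB -?EFinB; [congr EFin|]; lra.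
Qed.

(** The product measure integrates the measures of sections, so moving each fibre by a
    measure-preserving map changes nothing. The changes of variables on triangles are composites of
    such shears and reflections. *)
Lemma preserves_fiber (psi : mR -> mR -> mR) :
  measurable_fun setT (fun p : mR * mR => psi p.1 p.2) ->
  (forall x, preserves lam (psi x)) ->
  preserves (leb2 R) (fun p => (p.1, psi p.1 p.2)).
Proof.
move=> mpsi hpsi; split; first exact/measurable_fun_prod.
move=> X mX; apply: eq_integral => x _ /=.
have -> : xsection ((fun p : mR * mR => (p.1, psi p.1 p.2)) @^-1` X) x =
          psi x @^-1` (xsection X x).
  by apply/seteqP; split=> y; rewrite /xsection /= !inE.
by rewrite (hpsi x).2//; exact: measurable_xsection.
Qed.

Lemma preserves_swap : preserves (leb2 R) (fun p => (p.2, p.1)).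
Proof.
have mf : measurable_fun setT (fun p : mR * mR => (p.2, p.1)).
  exact: measurable_swap.
split => // X mX; apply/esym.
pose hf := isMeasurableFun.Build _ _ _ _ _ mf.
pose pf : {mfun (mR * mR)%type >-> (mR * mR)%type} := MeasurableFun.Pack (MeasurableFun.Class hf).
apply: (@product_measure_unique _ _ mR mR R lam lam (pushforward (leb2 R) pf)) => //.
move=> A B mA mB; transitivity (leb2 R (B `*` A)).
  by congr (leb2 R _); apply/seteqP; split=> p /= [].
by rewrite /leb2 /= product_measure1E// muleC.
Qed.

Lemma preserves_fiber_swap (psi : mR -> mR -> mR) :
  measurable_fun setT (fun p : mR * mR => psi p.1 p.2) ->
  (forall x, preserves lam (psi x)) ->
  preserves (leb2 R) (fun p => (psi p.2 p.1, p.2)).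
Proof.
move=> mpsi hpsi.
exact: (preserves_comp preserves_swap
  (preserves_comp (preserves_fiber mpsi hpsi) preserves_swap)).
Qed.

End MeasurePreserving.

(** * Measurability of continuous functions for the product sigma-algebra *)

Section ContinuousMeasurable.
Context (R : realType).
Notation mR := (measurableTypeR R).

(** Rounding [t] down to a grid of step [1/(n+1)] gives countably many slabs on each of which only
    measurability in [x] matters; continuity in [t] gives the pointwise limit. Adding one variable
    at a time leads to [R^3]. *)
Lemma measurable_fun_caratheodory d (T : measurableType d) (f : T * R -> R) :
  (forall t : R, measurable_fun setT (fun x => f (x, t))) ->
  (forall x, continuous (fun t : R => f (x, t))) ->
  measurable_fun [set: T * mR] (f : T * mR -> mR).
Proof.
move=> mf cf.
pose a (n : nat) (k : int) : R := k%:~R / n.+1%:R.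
pose h n (p : T * mR) := f (p.1, a n (Num.floor (n.+1%:R * (p.2 : R)))).
apply: (@measurable_fun_cvg _ _ _ _ h).
  move=> n _ Y mY; rewrite setTI.
  have -> : h n @^-1` Y = \bigcup_(k : int)
      (((fun x => f (x, a n k)) @^-1` Y) `*` `[a n k, a n (k + 1)[%classic).
    have n0 : 0 < n.+1%:R :> R by [].
    have fE t k : (t \in `[a n k, a n (k + 1)[) = (Num.floor (n.+1%:R * t) == k).
      by rewrite floor_eq in_itv /= /a ler_pdivrMr// ltr_pdivlMr// !(mulrC t).
    apply/seteqP; split=> [[x t] /= hY|[x t] [k _ [/= hx]]].
      by exists (Num.floor (n.+1%:R * t)) => //; split=> //=; rewrite fE.
    by rewrite fE /h /= => /eqP ->.
  apply: countable_bigcupT_measurable => // k.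
  apply: measurableX; last exact: measurable_itv.
  by rewrite -[X in measurable X]setTI; exact: mf.
move=> [x t] _; rewrite /h /=.
apply: (@continuous_cvg _ _ _ _ _ (fun n => a n (Num.floor (n.+1%:R * t)))
  (fun t => f (x, t)) t); first exact: cf.
apply/cvgrPdist_le => e e0; near=> n.
have n0 : 0 < n.+1%:R :> R by [].
have /andP[h1 h2] := floor_itv (n.+1%:R * t).
rewrite /a ler_norml; apply/andP; split.
  apply: (@le_trans _ _ 0); first by rewrite oppr_le0 ltW.
  by rewrite subr_ge0 ler_pdivrMr// (mulrC t).
rewrite lerBlDr -(ler_pM2r n0) mulrDl divfK ?gt_eqF// mulrC (le_trans (ltW h2))//.
rewrite intrD addrC lerD2r mulrC -ler_pdivrMr//.
rewrite (le_trans _ (_ : n%:R <= _))//; last by rewrite ler_nat.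
by rewrite div1r; near: n; exact: nbhs_infty_ger.
Unshelve. all: by end_near. Qed.

Lemma continuous_pair_left (U V W : topologicalType) (f : U * V -> W) (v : V) :
  continuous f -> continuous (fun u => f (u, v)).
Proof.
move=> cf u; apply: (continuous_comp (f := fun u => (u, v))); last exact: cf.
by apply: cvg_pair => //; exact: cvg_cst.
Qed.

Lemma continuous_pair_right (U V W : topologicalType) (f : U * V -> W) (u : U) :
  continuous f -> continuous (fun v => f (u, v)).
Proof.
move=> cf v; apply: (continuous_comp (f := fun v => (u, v))); last exact: cf.
by apply: cvg_pair => //; exact: cvg_cst.
Qed.

Lemma continuous2_measurable (f : R * R -> R) : continuous f ->
  measurable_fun [set: mR * mR] (f : mR * mR -> mR).
Proof.
move=> cf; apply: (@measurable_fun_caratheodory _ mR f) => [t|x].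
  by apply: continuous_measurable_fun; exact: continuous_pair_left.
exact: continuous_pair_right.
Qed.

Lemma continuous3_measurable (f : R3 R -> R) : continuous f ->
  measurable_fun [set: mR * mR * mR] (f : mR * mR * mR -> mR).
Proof.
move=> cf; apply: (@measurable_fun_caratheodory _ (mR * mR)%type f) => [t|x].
  by apply: continuous2_measurable; exact: (continuous_pair_left (f := f)).
exact: (continuous_pair_right (f := f)).
Qed.

End ContinuousMeasurable.

(** * Integrals over the tetrahedron and its faces *)

Section TetrahedronIntegrals.
Context (R : realType).
Notation mR := (measurableTypeR R).
Notation lam := (@lebesgue_measure R).

(** The inequalities are the signs of the barycentric coordinates [1 - y - z], [x], [y - x] and [z],
    which also provide the witness of the converse. *)
Lemma tetP (x : R3 R) : tet x <->
  [/\ 0 <= x.1.1, x.1.1 <= x.1.2, 0 <= x.2 & x.1.2 + x.2 <= 1].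
Proof.
case: x => [[x y] z] /=; split.
  case=> l [l0 l1 /= E].
  move: l1 E; rewrite !big_ord_recl !big_ord0 /vtx !(tnth_nth (0, 0, 0)) /= => l1.
  have := l0 ord0; have := l0 (lift ord0 ord0).
  have := l0 (lift ord0 (lift ord0 ord0)).
  have := l0 (lift ord0 (lift ord0 (lift ord0 ord0))).
  move=> h3 h2 h1 h0 [-> -> ->].
  rewrite /GRing.scale /= in l1 *.
  by split; lra.
move=> [h1 h2 h3 h4].
exists (fun i : 'I_4 => [tuple 1 - y - z; x; y - x; z]`_i); split.
- by case=> [[|[|[|[|//]]]]] Hi /=; lra.
- by rewrite !big_ord_recl big_ord0 /=; ring.
- rewrite !big_ord_recl !big_ord0 /vtx !(tnth_nth (0, 0, 0)) /=.
  by congr (_, _, _); rewrite /= ?oppr0 ?subr0 ?subrr ?scaler0 ?scalerN ?[_%:A]mulr1 ?addr0 ?add0r//; ring.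
Qed.

(** The faces 0, 1, 2 and 3 lie in the planes [y + z = 1], [x = 0], [x = y] and [z = 0]. *)
Lemma face_parE (s : R * R) :
  [/\ face_par 0 s = (1 - s.1 - s.2, 1 - s.2, s.2),
      face_par 1 s = (0, s.1, s.2),
      face_par 2 s = (s.1, s.1, s.2) &
      face_par 3 s = (s.1, s.1 + s.2, 0)].
Proof.
have e0 (i : 'I_4) (j : 'I_3) : face_vtx R i j =
    nth (0, 0, 0) [:: (0, 0, 0); (1, 1, 0); (0, 1, 0); (0, 0, 1)] (bump i j) :> R3 R.
  by rewrite /face_vtx /vtx (tnth_nth (0, 0, 0)).
have sE (a b : R) : a *: (b : R^o) = a * b by [].
by split; rewrite /face_par !e0 /=; congr (_, _, _); rewrite /= ?oppr0 ?subr0 ?subrr ?sE //; ring.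
Qed.

Lemma measurable_ge0_set d (T : measurableType d) (f : T -> mR) :
  measurable_fun setT f -> measurable [set x | 0 <= f x].
Proof.
move=> mf; have -> : [set x | 0 <= f x] = setT `&` f @^-1` `[0, +oo[%classic.
  by apply/seteqP; split=> x /=; rewrite in_itv /= andbT //; case.
by apply: mf => //; exact: measurable_itv.
Qed.

Lemma measurable_ref_tri : measurable (@ref_tri R : set (mR * mR)).
Proof.
have -> : (@ref_tri R : set (mR * mR)) = [set s | 0 <= s.1] `&` [set s | 0 <= s.2]
    `&` [set s | 0 <= 1 - (s.1 + s.2)].
  apply/seteqP; split => s /=; first by move=> [h1 h2 h3]; rewrite subr_ge0.
  by move=> [[h1 h2] h3]; split => //; rewrite -subr_ge0.
apply: measurableI; first apply: measurableI; apply: measurable_ge0_set => //.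
by apply: measurable_funB => //; exact: measurable_funD.
Qed.

Lemma measurable_tet : measurable (@tet R : set (mR * mR * mR)).
Proof.
have -> : (@tet R : set (mR * mR * mR)) = [set x | 0 <= x.1.1] `&`
    [set x | 0 <= x.1.2 - x.1.1]
    `&` [set x | 0 <= x.2] `&` [set s | 0 <= 1 - (s.1.2 + s.2)].
  apply/seteqP; split => s.
    by move/tetP=> [h1 h2 h3 h4]; rewrite /= !subr_ge0.
  by move=> /= [[[h1 h2] h3] h4]; apply/tetP; split; rewrite // -subr_ge0.
have m11 : measurable_fun setT (fun x : mR * mR * mR => x.1.1).
  exact: measurableT_comp.
have m12 : measurable_fun setT (fun x : mR * mR * mR => x.1.2).
  exact: measurableT_comp.
do 3?apply: measurableI; apply: measurable_ge0_set => //.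
  exact: measurable_funB.
by apply: measurable_funB => //; exact: measurable_funD.
Qed.

Notation I01 := (`[0, 1]%classic : set R).

Lemma lam_unit : lam I01 = 1%E.
Proof. by rewrite lebesgue_measure_itv /= lte_fin ltr01 oppr0 adde0. Qed.

Lemma leb2_square : leb2 R (I01 `*` I01) = 1%E.
Proof.
transitivity (lam I01 * lam I01)%E; first exact: product_measure1E.
by rewrite lam_unit mule1.
Qed.

Lemma leb3_cube : leb3 R (I01 `*` I01 `*` I01) = 1%E.
Proof.
transitivity (leb2 R (I01 `*` I01) * lam I01)%E.
  by apply: product_measure1E => //; exact: measurableX.
by rewrite leb2_square lam_unit mule1.
Qed.

Lemma ref_tri_square : @ref_tri R `<=` I01 `*` I01.
Proof. by move=> s [h1 h2 h3]; split; rewrite /= in_itv /=; lra. Qed.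

Lemma tet_cube : @tet R `<=` I01 `*` I01 `*` I01.
Proof. by move=> x /tetP[h1 h2 h3 h4]; split; [split|]; rewrite /= in_itv /=; lra. Qed.

Lemma compact_bounded_fun (T : topologicalType) (A K : set T) (f : T -> R) :
  compact K -> A `<=` K -> continuous f -> [bounded f x | x in A].
Proof.
move=> cK AK cf.
have /compact_bounded : compact (f @` K).
  by apply: continuous_compact => //; exact: continuous_subspaceT.
move=> [M [Mr HM]]; exists M; split => // y /HM Hy x /AK Kx.
by apply: Hy; exists x.
Qed.

Lemma integrable_leb2 (A : set (R * R)) (f : R * R -> R) :
  measurable (A : set (mR * mR)) -> A `<=` I01 `*` I01 -> continuous f ->
  (leb2 R).-integrable A (EFin \o f).
Proof.
move=> mA sA cf; apply: measurable_bounded_integrable => //.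
- rewrite (@le_lt_trans _ _ 1%E) ?ltry// -leb2_square.
  by apply: le_measure => //; rewrite inE//; exact: measurableX.
- exact: measurable_funTS (continuous2_measurable cf).
- apply: (compact_bounded_fun _ sA) => //.
  by apply: compact_setX; exact: segment_compact.
Qed.

Lemma integrable_ref_tri (f : R * R -> R) : continuous f ->
  (leb2 R).-integrable (@ref_tri R) (EFin \o f).
Proof.
by apply: integrable_leb2; [exact: measurable_ref_tri|exact: ref_tri_square].
Qed.

Lemma integrable_tet (f : R3 R -> R) : continuous f ->
  (leb3 R).-integrable (@tet R) (EFin \o f).
Proof.
move=> cf; apply: measurable_bounded_integrable => //.
- exact: measurable_tet.
- rewrite (@le_lt_trans _ _ 1%E) ?ltry// -leb3_cube.
  apply: le_measure => //; rewrite ?inE//; [exact: measurable_tet| |exact: tet_cube].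
  by apply: measurableX => //; exact: measurableX.
- exact: measurable_funTS (continuous3_measurable cf).
- apply: (compact_bounded_fun _ tet_cube) => //.
  by do 2?apply: compact_setX; exact: segment_compact.
Qed.

End TetrahedronIntegrals.

(** * Fubini's theorem in two and three variables *)

Section LebesgueProduct.
Context (R : realType).
Notation mR := (measurableTypeR R).
Notation lam := (@lebesgue_measure R).

(* The library instance making a product measure sigma-finite is shadowed by
   the one for subprobabilities. *)
Definition leb2_fun : set (mR * mR)%type -> \bar R := leb2 R.

HB.instance Definition _ := Measure.on leb2_fun.

Lemma leb2_sigma_finite : sigma_finite setT leb2_fun.
Proof.
have /sigma_finiteP[F [TF ndF Foo]] := sigma_finiteT lam.
exists (fun n => F n `*` F n).
  rewrite -setXTT TF predeqE => -[x y]; split.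
    move=> [/= [n _ Fnx] [k _ Gky]]; exists (maxn n k) => //; split.
    - by move: x Fnx; exact/subsetPset/ndF/leq_maxl.
    - by move: y Gky; exact/subsetPset/ndF/leq_maxr.
  by move=> [n _ []/= ? ?]; split; exists n.
move=> k; have [? ?] := Foo k.
split; first exact: measurableX.
rewrite /leb2_fun /leb2 /= product_measure1E//.
by rewrite lte_mul_pinfty// ge0_fin_numE.
Qed.

HB.instance Definition _ :=
  Measure_isSigmaFinite.Build _ _ _ leb2_fun leb2_sigma_finite.

Lemma leb2_fubini (k : R * R -> \bar R) : (leb2 R).-integrable setT k ->
  (\int[leb2 R]_p k p = \int[lam]_x \int[lam]_y k (x, y))%E /\
  (\int[leb2 R]_p k p = \int[lam]_y \int[lam]_x k (x, y))%E.
Proof.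
by move=> ik; split; apply/esym; [exact: integral12_prod_meas1|exact: integral21_prod_meas1].
Qed.

Lemma leb3_fubini (k : R3 R -> \bar R) : (leb3 R).-integrable setT k ->
  (\int[leb3 R]_p k p = \int[leb2 R]_p \int[lam]_z k (p, z))%E /\
  (\int[leb3 R]_p k p = \int[lam]_z \int[leb2 R]_p k (p, z))%E.
Proof.
move=> ik; split; apply/esym.
  exact: (@integral12_prod_meas1 _ _ _ _ R leb2_fun lam k ik).
exact: (@integral21_prod_meas1 _ _ _ _ R leb2_fun lam k ik).
Qed.

End LebesgueProduct.

(** * Integrals of partial derivatives along lines *)

Section DirectionalIBP.
Context (R : realType).
Notation mR := (measurableTypeR R).
Notation lam := (@lebesgue_measure R).

Definition C1 (G : R3 R -> R) : Prop := continuous G /\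
  forall i, (forall x, derivable G x (unit_vec R i)) /\ continuous (pd i G).

Lemma is_derive_line (G : R3 R -> R) (i : 'I_3) (x : R -> R3 R) (t : R) :
  (forall y, derivable G y (unit_vec R i)) ->
  (forall s r, x (s + r) = s *: unit_vec R i + x r) ->
  is_derive t (1 : R) (G \o x) (pd i G (x t)).
Proof.
move=> dG xE.
have E : (fun h : R => h^-1 *: (((G \o x) \o shift t) (h *: (1 : R)) - (G \o x) t)) =
    (fun h : R => h^-1 *: ((G \o shift (x t)) (h *: unit_vec R i) - G (x t))).
  by apply/funext => h /=; rewrite -xE /= [h *: 1]mulr1.
by apply: DeriveDef; [rewrite /derivable E; exact: dG|rewrite /derive E].
Qed.

Lemma segment_FTC (F f : R -> R) (a b : R) :
  (forall t, is_derive t (1 : R) F (f t)) -> continuous f -> a <= b ->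
  (\int[lam]_(t in `[a, b]) (f t)%:E = (F b - F a)%:E)%E.
Proof.
move=> dF cf; rewrite le_eqVlt => /orP[/eqP <-|ab].
  by rewrite set_itv1 integral_set1 subrr.
have cF : continuous F.
  by move=> x; apply: differentiable_continuous; apply/derivable1_diffP; apply: ex_derive.
rewrite (@continuous_FTC2 _ f F)//.
- exact: continuous_subspaceT.
- split.
  + by move=> x _; exact: ex_derive.
  + by apply: cvg_at_right_filter; exact: cF.
  + by apply: cvg_at_left_filter; exact: cF.
- by move=> x _; rewrite derive1E derive_val.
Qed.

(** Keeping the condition [D], that the line meets the set, apart from the segment lets the outer
    integral recognise the result as a function restricted to a projection of the tetrahedron. *)
Lemma integral_fiber (A : set R) (D : Prop) (F f : R -> R) (a b : R) :
  (forall t, is_derive t (1 : R) F (f t)) -> continuous f ->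
  (D -> a <= b) -> (forall t, A t <-> D /\ a <= t <= b) ->
  (\int[lam]_t ((f \_ A) t)%:E = (if `[< D >] then F b - F a else 0)%:E)%E.
Proof.
move=> dF cf Dab AE; have [/asboolP d|/asboolPn nd] := ifPn.
  rewrite -segment_FTC//; last exact: Dab.
  rewrite [RHS]integral_mkcond; apply: eq_integral => t _.
  rewrite restrict_EFin; congr (EFin (_ \_ _ _)).
  by apply/seteqP; split=> s; rewrite /= in_itv /= AE; [case|].
rewrite integral0_eq// => t _; rewrite patchE.
by case: ifPn => // /set_mem /AE[].
Qed.

Lemma tet_int_patch (g : R3 R -> R) :
  tet_int g = fine (\int[leb3 R]_x ((g \_ (@tet R)) x)%:E)%E.
Proof. by rewrite /tet_int Rintegral_mkcond. Qed.

Lemma integrable_tet_patch (g : R3 R -> R) : continuous g ->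
  (leb3 R).-integrable setT (EFin \o (g \_ (@tet R))).
Proof.
move=> /integrable_tet ig; rewrite -restrict_EFin.
by apply/integrable_restrict => //; [exact: measurable_tet|rewrite setTI].
Qed.

(** Fubini's theorem in space controls almost every slice; continuity gives integrability on each of
    them, so that the theorem can be applied again inside a slice without an exceptional set. *)
Lemma integrable_tet_section (g : R3 R -> R) (z : R) : continuous g ->
  (leb2 R).-integrable setT (fun p => ((g \_ (@tet R)) (p, z))%:E).
Proof.
move=> cg; pose A := [set p : R * R | tet (p, z)].
have -> : (fun p => ((g \_ (@tet R)) (p, z))%:E) =
    EFin \o ((fun p => g (p, z)) \_ A).
  by apply/funext => p /=; rewrite !patchE; congr (EFin (if _ then _ else _)).
have mA : measurable (A : set (mR * mR)).
  have -> : A = ysection (@tet R : set (mR * mR * mR)) z.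
    by apply/seteqP; split=> p; rewrite /ysection /= inE.
  by apply: measurable_ysection; exact: measurable_tet.
rewrite -restrict_EFin.
apply/(@integrable_mkcond _ _ _ (leb2 R) A (EFin \o (fun p => g (p, z)))) => //.
apply: integrable_leb2 => //; last exact: (continuous_pair_left (f := g)).
by move=> p /tet_cube[].
Qed.

Lemma integrable_ref_patch (h : R * R -> R) : continuous h ->
  (leb2 R).-integrable setT (EFin \o (h \_ (@ref_tri R))).
Proof.
move=> /integrable_ref_tri ig; rewrite -restrict_EFin.
by apply/integrable_restrict => //; [exact: measurable_ref_tri|rewrite setTI].
Qed.

Lemma Rintegral_ref_patch (h : R * R -> R) :
  \int[leb2 R]_(s in @ref_tri R) h s =
  fine (\int[leb2 R]_s ((h \_ (@ref_tri R)) s)%:E)%E.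
Proof. by rewrite Rintegral_mkcond. Qed.

Lemma continuous_pair (U V W : topologicalType) (f : U -> V) (g : U -> W) :
  continuous f -> continuous g -> continuous (fun u => (f u, g u)).
Proof. by move=> cf cg u; apply: cvg_pair; [exact: cf|exact: cg]. Qed.

Lemma integral_tet_fiber (G : R3 R -> R) (i : 'I_3) (x : R -> R3 R) (D : Prop)
    (a b : R) : C1 G ->
  (forall s r, x (s + r) = s *: unit_vec R i + x r) -> continuous x ->
  (D -> a <= b) -> (forall t, tet (x t) <-> D /\ a <= t <= b) ->
  (\int[lam]_t ((pd i G \_ (@tet R)) (x t))%:E =
   (if `[< D >] then G (x b) - G (x a) else 0)%:E)%E.
Proof.
move=> [cG dG] xE cx Dab TE; have [dGi cGi] := dG i.
have dF t : is_derive t (1 : R) (G \o x) ((pd i G \o x) t) by exact: is_derive_line.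
have cf : continuous (pd i G \o x).
  by move=> t; apply: continuous_comp; [exact: cx|exact: cGi].
exact: (integral_fiber (A := [set t | tet (x t)]) dF cf Dab TE).
Qed.

Lemma unit_vec_line (x1 x2 x3 s r : R) :
  [/\ (s + r, x2, x3) = s *: unit_vec R 0 + (r, x2, x3),
      (x1, s + r, x3) = s *: unit_vec R 1 + (x1, r, x3) &
      (x1, x2, s + r) = s *: unit_vec R 2 + (x1, x2, r)].
Proof.
by split; rewrite /unit_vec /=; congr (_, _, _);
  rewrite /= ?[_ *: 0]mulr0 ?[_ *: 1]mulr1 ?add0r.
Qed.

Lemma tet_int_pd0 (G : R3 R -> R) : C1 G ->
  tet_int (pd 0 G) =
  \int[leb2 R]_(s in @ref_tri R) (G (s.1, s.1, s.2) - G (0, s.1, s.2)).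
Proof.
move=> /[dup] C1G [cG dG]; have [_ cG0] := dG 0.
rewrite tet_int_patch Rintegral_ref_patch; congr fine.
pose h (s : R * R) := G (s.1, s.1, s.2) - G (0, s.1, s.2).
have ch : continuous h.
  move=> s; apply: continuousB; apply: continuous_comp; try exact: cG.
    apply: continuous_pair; first apply: continuous_pair; move=> ?;
      [exact: cvg_fst|exact: cvg_fst|exact: cvg_snd].
  apply: continuous_pair; first apply: continuous_pair; move=> ?;
      [exact: cvg_cst|exact: cvg_fst|exact: cvg_snd].
(* The order of integration is chosen so that the direction of the derivative is innermost. *)
rewrite (leb3_fubini (integrable_tet_patch cG0)).2.
rewrite [RHS](leb2_fubini (integrable_ref_patch ch)).2.
apply: eq_integral => z _.
rewrite [LHS](leb2_fubini (integrable_tet_section z cG0)).2.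
apply: eq_integral => y _ /=.
rewrite (@integral_tet_fiber _ _ (fun t => (t, y, z)) (ref_tri (y, z)) 0 y) => //.
- by move=> s r; have [] := unit_vec_line 0 y z s r.
- by do 2?apply: continuous_pair; move=> t; [exact: cvg_id|exact: cvg_cst|exact: cvg_cst].
- by case.
- move=> t; split=> [/tetP[/= h1 h2 h3 h4]|[[/= h1 h2 h3] /andP[h4 h5]]].
    by split; [split => /=|]; lra.
  by apply/tetP; split=> /=; lra.
Qed.

Lemma tet_int_pd1 (G : R3 R -> R) : C1 G ->
  tet_int (pd 1 G) =
  \int[leb2 R]_(s in @ref_tri R) (G (s.1, 1 - s.2, s.2) - G (s.1, s.1, s.2)).
Proof.
move=> /[dup] C1G [cG dG]; have [_ cG0] := dG 1.
rewrite tet_int_patch Rintegral_ref_patch; congr fine.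
pose h (s : R * R) := G (s.1, 1 - s.2, s.2) - G (s.1, s.1, s.2).
have ch : continuous h.
  move=> s; apply: continuousB; apply: continuous_comp; try exact: cG.
    apply: continuous_pair; first apply: continuous_pair; move=> ?;
      [exact: cvg_fst|apply: cvgB; [exact: cvg_cst|exact: cvg_snd]|exact: cvg_snd].
  apply: continuous_pair; first apply: continuous_pair; move=> ?;
      [exact: cvg_fst|exact: cvg_fst|exact: cvg_snd].
rewrite (leb3_fubini (integrable_tet_patch cG0)).2.
rewrite [RHS](leb2_fubini (integrable_ref_patch ch)).2.
apply: eq_integral => z _.
rewrite [LHS](leb2_fubini (integrable_tet_section z cG0)).1.
apply: eq_integral => y _ /=.
rewrite (@integral_tet_fiber _ _ (fun t => (y, t, z)) (ref_tri (y, z)) y (1 - z)) => //.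
- by move=> s r; have [] := unit_vec_line y 0 z s r.
- by do 2?apply: continuous_pair; move=> t; [exact: cvg_cst|exact: cvg_id|exact: cvg_cst].
- by case=> /= *; lra.
- move=> t; split=> [/tetP[/= h1 h2 h3 h4]|[[/= h1 h2 h3] /andP[h4 h5]]].
    by split; [split => /=|]; lra.
  by apply/tetP; split=> /=; lra.
Qed.

(** The projection of the tetrahedron along the third axis. The projections along the other two axes
    are the reference triangle itself; this one has to be sheared onto it. *)
Definition base_tri : set (R * R) := [set p | [/\ 0 <= p.1, p.1 <= p.2 & p.2 <= 1]].

Lemma tet_int_pd2 (G : R3 R -> R) : C1 G ->
  tet_int (pd 2 G) =
  \int[leb2 R]_(p in base_tri) (G (p.1, p.2, 1 - p.2) - G (p.1, p.2, 0)).
Proof.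
move=> /[dup] C1G [cG dG]; have [_ cG0] := dG 2.
rewrite tet_int_patch Rintegral_mkcond; congr fine.
rewrite (leb3_fubini (integrable_tet_patch cG0)).1.
apply: eq_integral => -[x y] _ /=.
rewrite (@integral_tet_fiber _ _ (fun t => (x, y, t)) (base_tri (x, y)) 0 (1 - y)) => //.
- by move=> s r; have [] := unit_vec_line x y 0 s r.
- by do 2?apply: continuous_pair; move=> t; [exact: cvg_cst|exact: cvg_cst|exact: cvg_id].
- by case=> /= *; lra.
- move=> t; split=> [/tetP[/= h1 h2 h3 h4]|[[/= h1 h2 h3] /andP[h4 h5]]].
    by split; [split => /=|]; lra.
  by apply/tetP; split=> /=; lra.
Qed.

End DirectionalIBP.

(** * Polynomial functions *)

Section PolynomialCalculus.
Context (R : realType).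
Implicit Types (p q : poly3 R) (x v : R3 R) (i j : 'I_3).

Definition PX i : poly3 R := mpolyX R (mnm1 i).

Lemma coord3E x : [/\ coord3 x 0 = x.1.1, coord3 x 1 = x.1.2 & coord3 x 2 = x.2].
Proof. by rewrite /coord3 !(tnth_nth 0). Qed.

Lemma forall_ord3 (P : 'I_3 -> Prop) : P 0 -> P 1 -> P 2 -> forall j, P j.
Proof.
move=> P0 P1 P2 [[|[|[|//]]] Hj].
- by have -> : Ordinal Hj = 0 by exact/val_inj.
- by have -> : Ordinal Hj = 1 by exact/val_inj.
- by have -> : Ordinal Hj = 2 by exact/val_inj.
Qed.

Lemma sum_ord3 (V : zmodType) (f : 'I_3 -> V) : \sum_(j < 3) f j = f 0 + f 1 + f 2.
Proof.
rewrite !big_ord_recl big_ord0 addr0 addrA.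
by congr (f _ + f _ + f _); exact/val_inj.
Qed.

Lemma sum_ord4 (V : zmodType) (f : 'I_4 -> V) :
  \sum_(j < 4) f j = f 0 + f 1 + f 2 + f 3.
Proof.
rewrite !big_ord_recl big_ord0 addr0 !addrA.
by congr (f _ + f _ + f _ + f _); exact/val_inj.
Qed.

Lemma coord3_linear (a : R) x v j :
  coord3 (a *: v + x) j = a * coord3 v j + coord3 x j.
Proof. by move: j; apply: forall_ord3; rewrite /coord3 !(tnth_nth 0). Qed.

Lemma coord3_unit_vec i j : coord3 (unit_vec R i) j = (i == j)%:R.
Proof. by move: j; apply: forall_ord3; rewrite /coord3 (tnth_nth 0). Qed.

Lemma continuous_coord3 j : continuous (fun x : R3 R => coord3 x j).
Proof.
move: j; apply: forall_ord3.
- have -> : (fun x : R3 R => coord3 x 0) = (fst \o fst) by apply/funext => x; have [] := coord3E x.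
  by move=> x; apply: continuous_comp; exact: cvg_fst.
- have -> : (fun x : R3 R => coord3 x 1) = (snd \o fst) by apply/funext => x; have [] := coord3E x.
  by move=> x; apply: continuous_comp; [exact: cvg_fst|exact: cvg_snd].
- have -> : (fun x : R3 R => coord3 x 2) = snd by apply/funext => x; have [] := coord3E x.
  by move=> x; exact: cvg_snd.
Qed.

Lemma is_derive_coord3 x v j : is_derive x v (fun y : R3 R => coord3 y j) (coord3 v j).
Proof.
have H : (fun h : R => h^-1 *: (((fun y : R3 R => coord3 y j) \o shift x) (h *: v) - coord3 x j))
   @ 0^' --> coord3 v j.
  apply: cvg_near_cst; near=> h.
  have h0 : h != 0 by near: h; exact: nbhs_dnbhs_neq.
  by rewrite /= coord3_linear addrK /GRing.scale /= mulrA mulVf// mul1r.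
by apply: DeriveDef; [exact: cvgP H|exact: (cvg_lim _ H)].
Unshelve. all: by end_near. Qed.

Lemma peval0 x : peval 0 x = 0. Proof. exact: meval0. Qed.
Lemma pevalC c x : peval (mpolyC 3 c) x = c. Proof. exact: mevalC. Qed.
Lemma pevalD p q x : peval (p + q) x = peval p x + peval q x.
Proof. exact: mevalD. Qed.
Lemma pevalN p x : peval (- p) x = - peval p x. Proof. exact: mevalN. Qed.
Lemma pevalB p q x : peval (p - q) x = peval p x - peval q x.
Proof. exact: mevalB. Qed.
Lemma pevalM p q x : peval (p * q) x = peval p x * peval q x.
Proof. exact: mevalM. Qed.
Lemma pevalZ c p x : peval (c *: p) x = c * peval p x. Proof. exact: mevalZ. Qed.
Lemma peval_PX i x : peval (PX i) x = coord3 x i. Proof. exact: mevalXU. Qed.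
Lemma peval_sum (I : Type) (r : seq I) (P : pred I) (F : I -> poly3 R) x :
  peval (\sum_(k <- r | P k) F k) x = \sum_(k <- r | P k) peval (F k) x.
Proof. exact: raddf_sum. Qed.

Lemma mpoly_ring_ind n (S : comRingType) (Q : mpoly.mpoly n S -> Prop) :
  (forall c, Q (mpolyC n c)) -> (forall k, Q (mpolyX S (mnm1 k))) ->
  (forall f g, Q f -> Q g -> Q (f + g)) -> (forall f g, Q f -> Q g -> Q (f * g)) ->
  forall f, Q f.
Proof.
move=> QC QX QD QM p; rewrite [p]mpolyE; apply: big_ind.
- by rewrite -mpolyC0.
- exact: QD.
move=> m _; rewrite -mul_mpolyC; apply: (QM) => //; rewrite mpolyXE_id.
apply: big_ind => [||i _]; [by rewrite -mpolyC1|exact: QM|].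
by elim: (m i) => [|k IH]; rewrite ?expr0 ?exprS; [rewrite -mpolyC1|exact: QM].
Qed.

Lemma C1M (f g : R3 R -> R) : C1 f -> C1 g -> C1 (f * g) /\
  forall i, pd i (f * g) = pd i f * g + f * pd i g.
Proof.
move=> [cf df] [cg dg].
have E i : pd i (f * g) = pd i f * g + f * pd i g.
  apply/funext => x; rewrite /pd deriveM; [|exact: (df i).1|exact: (dg i).1].
  by rewrite addrC !fctE; congr (_ + _); exact: mulrC.
split=> //; split; first by move=> x; apply: continuousM; [exact: cf|exact: cg].
move=> i; split; first by move=> x; apply: derivableM; [exact: (df i).1|exact: (dg i).1].
rewrite E => x; apply: continuousD; apply: continuousM;
  [exact: (df i).2|exact: cg|exact: cf|exact: (dg i).2].
Qed.

Lemma C1_peval p : C1 (peval p) /\ forall i, pd i (peval p) = peval (mderiv i p).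
Proof.
elim/mpoly_ring_ind: p => [c|j|p q [Cp dp] [Cq dq]|p q [Cp dp] [Cq dq]].
- have -> : peval (mpolyC 3 c) = cst c by apply/funext => x; rewrite pevalC.
  have E i : pd i (cst c) = cst 0 :> (R3 R -> R) by apply/funext => x; exact: derive_cst.
  split=> [|i]; last by rewrite E mderivC; apply/funext => x; rewrite peval0.
  split=> [|i]; first by move=> x; exact: cvg_cst.
  by split=> [x|]; [exact: derivable_cst|rewrite E => x; exact: cvg_cst].
- have -> : peval (mpolyX R (mnm1 j)) = (fun x => coord3 x j).
    by apply/funext => x; rewrite peval_PX.
  have E i : pd i (fun x : R3 R => coord3 x j) = cst (i == j)%:R.
    apply/funext => x; rewrite /pd (@derive_val _ _ _ _ _ _ _ (is_derive_coord3 x _ j)).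
    exact: coord3_unit_vec.
  split=> [|i]; last first.
    rewrite E mderivX; apply/funext => x; rewrite mnm1E pevalZ eq_sym.
    case: eqP => [->|_]; rewrite ?mul0r ?mul1r//.
    have -> : mnm_sub (mnm1 i) (mnm1 i) = mnm0.
      by apply/mnmP => k; rewrite mnmBE subnn mnm0E.
    by rewrite mpolyX0 /peval meval1.
  split=> [|i]; first exact: continuous_coord3.
  split=> [x|]; last by rewrite E => x; exact: cvg_cst.
  exact: (@ex_derive _ _ _ _ _ _ _ (is_derive_coord3 x _ j)).
- have -> : peval (p + q) = peval p + peval q by apply/funext => x; rewrite pevalD.
  have E i : pd i (peval p + peval q) = peval (mderiv i (p + q)).
    apply/funext => x; rewrite /pd deriveD; [|exact: (Cp.2 i).1|exact: (Cq.2 i).1].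
    by rewrite mderivD pevalD -dp -dq.
  split=> //; split=> [x|i]; first by apply: continuousD; [exact: Cp.1|exact: Cq.1].
  split=> [x|]; first by apply: derivableD; [exact: (Cp.2 i).1|exact: (Cq.2 i).1].
  have -> : pd i (peval p + peval q) = pd i (peval p) + pd i (peval q).
    by rewrite E dp dq; apply/funext => x; rewrite mderivD pevalD.
  by move=> x; apply: continuousD; [exact: (Cp.2 i).2|exact: (Cq.2 i).2].
- have -> : peval (p * q) = peval p * peval q by apply/funext => x; rewrite pevalM.
  have [C E] := C1M Cp Cq; split=> // i.
  by rewrite E dp dq; apply/funext => x; rewrite mderivM pevalD !pevalM.
Qed.

Lemma continuous_peval p : continuous (peval p).
Proof. by have [[]] := C1_peval p. Qed.

End PolynomialCalculus.

(** * The divergence theorem *)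

Section Green.
Context (R : realType).
Notation mR := (measurableTypeR R).
Notation lam := (@lebesgue_measure R).
Implicit Types (p q z : poly3 R) (i j : 'I_3) (F : 'I_4) (G f g : R3 R -> R).

(** The factor [face_jac] is left out: it is absorbed by [area_normal], and the divergence theorem
    gets integer coefficients. *)
Definition ref_face_int F f : R := \int[leb2 R]_(s in @ref_tri R) f (face_par F s).

Definition face_integrable F f : Prop :=
  (leb2 R).-integrable (@ref_tri R) (EFin \o (f \o face_par F)).

Definition tet_integrable f : Prop := (leb3 R).-integrable (@tet R) (EFin \o f).

Lemma forall_ord4 (P : 'I_4 -> Prop) : P 0 -> P 1 -> P 2 -> P 3 -> forall F, P F.
Proof.
move=> P0 P1 P2 P3 [[|[|[|[|//]]]] HF].
- by have -> : Ordinal HF = 0 by exact/val_inj.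
- by have -> : Ordinal HF = 1 by exact/val_inj.
- by have -> : Ordinal HF = 2 by exact/val_inj.
- by have -> : Ordinal HF = 3 by exact/val_inj.
Qed.

Lemma continuous_pairing3 (U : topologicalType) (a b c : U -> R) :
  continuous a -> continuous b -> continuous c ->
  continuous (fun s => (a s, b s, c s)).
Proof. by move=> ca cb cc; do 2?apply: continuous_pair. Qed.

Lemma continuous_face_par F : continuous (@face_par R F).
Proof.
have c1 : continuous (fun s : R * R => s.1) by move=> s; exact: cvg_fst.
have c2 : continuous (fun s : R * R => s.2) by move=> s; exact: cvg_snd.
have cc (c : R) : continuous (fun _ : R * R => c) by move=> s; exact: cvg_cst.
have cB (a b : R * R -> R) : continuous a -> continuous b -> continuous (fun s => a s - b s).
  by move=> ca cb s; apply: continuousB; [exact: ca|exact: cb].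
have cD (a b : R * R -> R) : continuous a -> continuous b -> continuous (fun s => a s + b s).
  by move=> ca cb s; apply: continuousD; [exact: ca|exact: cb].
move: F; apply: forall_ord4.
- have -> : face_par 0 = (fun s : R * R => (1 - s.1 - s.2, 1 - s.2, s.2)).
    by apply/funext => s; have [] := face_parE s.
  by apply: continuous_pairing3 => //; [apply: (cB (fun s => 1 - s.1)) => //; apply: (cB (fun=> 1))|apply: (cB (fun=> 1))].
- have -> : face_par 1 = (fun s : R * R => (0, s.1, s.2)).
    by apply/funext => s; have [] := face_parE s.
  exact: continuous_pairing3.
- have -> : face_par 2 = (fun s : R * R => (s.1, s.1, s.2)).
    by apply/funext => s; have [] := face_parE s.
  exact: continuous_pairing3.
- have -> : face_par 3 = (fun s : R * R => (s.1, s.1 + s.2, 0)).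
    by apply/funext => s; have [] := face_parE s.
  by apply: continuous_pairing3 => //; apply: cD.
Qed.

Lemma continuous_face f F : continuous f -> continuous (f \o face_par F).
Proof.
by move=> cf s; apply: continuous_comp; [exact: continuous_face_par|exact: cf].
Qed.

Lemma continuous_face_integrable f F : continuous f -> face_integrable F f.
Proof. by move=> cf; apply: integrable_ref_tri; exact: continuous_face. Qed.

Lemma ref_face_intD F f g : face_integrable F f -> face_integrable F g ->
  ref_face_int F (fun x => f x + g x) = ref_face_int F f + ref_face_int F g.
Proof. by move=> *; apply: RintegralD => //; exact: measurable_ref_tri. Qed.

Lemma ref_face_intB F f g : face_integrable F f -> face_integrable F g ->
  ref_face_int F (fun x => f x - g x) = ref_face_int F f - ref_face_int F g.
Proof. by move=> *; apply: RintegralB => //; exact: measurable_ref_tri. Qed.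

Lemma ref_face_intZ F (a : R) f : face_integrable F f ->
  ref_face_int F (fun x => a * f x) = a * ref_face_int F f.
Proof. by move=> *; apply: RintegralZl => //; exact: measurable_ref_tri. Qed.

Lemma tet_intD f g : tet_integrable f -> tet_integrable g ->
  tet_int (fun x => f x + g x) = tet_int f + tet_int g.
Proof. by move=> *; apply: RintegralD => //; exact: measurable_tet. Qed.

Lemma tet_intB f g : tet_integrable f -> tet_integrable g ->
  tet_int (fun x => f x - g x) = tet_int f - tet_int g.
Proof. by move=> *; apply: RintegralB => //; exact: measurable_tet. Qed.

Lemma tet_intZ (a : R) f : tet_integrable f ->
  tet_int (fun x => a * f x) = a * tet_int f.
Proof. by move=> *; apply: RintegralZl => //; exact: measurable_tet. Qed.

Lemma tet_integrableD f g : tet_integrable f -> tet_integrable g ->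
  tet_integrable (fun x => f x + g x).
Proof.
by move=> hf hg; exact: (integrableD (@measurable_tet R) hf hg).
Qed.

Lemma preserves_tri (phi : R * R -> R * R) (D : set (R * R)) (h : R * R -> R) :
  preserves (leb2 R) phi -> continuous phi -> continuous h ->
  measurable (D : set (mR * mR)) -> phi @^-1` D = @ref_tri R ->
  \int[leb2 R]_(s in D) h s = \int[leb2 R]_(s in @ref_tri R) h (phi s).
Proof.
move=> pphi cphi ch mD DE.
rewrite (@preserves_integral _ _ _ (leb2 R) phi D h) ?DE//; first exact: continuous2_measurable.
by apply: integrable_ref_tri => s; apply: continuous_comp; [exact: cphi|exact: ch].
Qed.

(** An affine involution of the reference triangle exchanging two vertices. It reconciles the
    parametrisation of the slanted face by projection with [face_par 0]. *)
Lemma preserves_tri_reflect : preserves (leb2 R) (fun s => (1 - s.2 - s.1, s.2)).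
Proof.
apply: (@preserves_fiber_swap R (fun x y => 1 - x - y)).
  by do 2?apply: measurable_funB.
by move=> x; exact: preserves_reflect.
Qed.

Lemma continuous_tri_reflect : continuous (fun s : R * R => (1 - s.2 - s.1, s.2)).
Proof.
apply: continuous_pair; last by move=> s; exact: cvg_snd.
move=> s; apply: cvgB; last exact: cvg_fst.
by apply: cvgB; [exact: cvg_cst|exact: cvg_snd].
Qed.

Lemma ref_tri_reflect : (fun s : R * R => (1 - s.2 - s.1, s.2)) @^-1` @ref_tri R = @ref_tri R.
Proof. by apply/seteqP; split=> s [/= h1 h2 h3]; split=> /=; lra. Qed.

Lemma measurable_base_tri : measurable (@base_tri R : set (mR * mR)).
Proof.
have -> : (@base_tri R : set (mR * mR)) = [set s | 0 <= s.1] `&` [set s | 0 <= s.2 - s.1]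
    `&` [set s | 0 <= 1 - s.2].
  apply/seteqP; split => s /=; first by move=> [h1 h2 h3]; rewrite !subr_ge0.
  by move=> [[h1 h2] h3]; split; rewrite // -subr_ge0.
apply: measurableI; first apply: measurableI; apply: measurable_ge0_set => //.
  exact: measurable_funB.
exact: measurable_funB.
Qed.

Lemma base_tri_shear f : continuous f ->
  \int[leb2 R]_(s in @base_tri R) f (s.1, s.2, 0) = ref_face_int 3 f.
Proof.
move=> cf; rewrite /ref_face_int.
transitivity (\int[leb2 R]_(s in @ref_tri R) f (s.1, s.1 + s.2, 0)); last first.
  by apply: eq_Rintegral => s _; have [_ _ _ ->] := face_parE s.
rewrite (@preserves_tri (fun s => (s.1, s.1 + s.2)) _ (fun s => f (s.1, s.2, 0)))//.
- apply: (@preserves_fiber R (fun x y => x + y)); first exact: measurable_funD.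
  by move=> x; exact: preserves_shift.
- apply: continuous_pair => s; first exact: cvg_fst.
  by apply: cvgD; [exact: cvg_fst|exact: cvg_snd].
- move=> s; apply: continuous_comp; last exact: cf.
  apply: continuous_pairing3 => t; [exact: cvg_fst|exact: cvg_snd|exact: cvg_cst].
- exact: measurable_base_tri.
- by apply/seteqP; split=> s [/= h1 h2 h3]; split=> /=; lra.
Qed.

Lemma base_tri_slanted f : continuous f ->
  \int[leb2 R]_(s in @base_tri R) f (s.1, s.2, 1 - s.2) = ref_face_int 0 f.
Proof.
move=> cf; rewrite /ref_face_int.
transitivity (\int[leb2 R]_(s in @ref_tri R) f (1 - s.2 - s.1, 1 - s.2, 1 - (1 - s.2))); last first.
  apply: eq_Rintegral => s _; have [-> _ _ _] := face_parE s.
  by congr (f (_, _, _)); ring.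
rewrite (@preserves_tri (fun s => (1 - s.2 - s.1, 1 - s.2)) _ (fun s => f (s.1, s.2, 1 - s.2)))//.
(* The map is the reflection of the triangle followed by [y -> 1 - y] in the second coordinate. *)
- have := preserves_comp (@preserves_fiber R (fun x y => 1 - y) _ _) preserves_tri_reflect.
  apply; first exact: measurable_funB.
  by move=> x; exact: preserves_reflect.
- apply: continuous_pair => s; last by apply: cvgB; [exact: cvg_cst|exact: cvg_snd].
  apply: cvgB; last exact: cvg_fst.
  by apply: cvgB; [exact: cvg_cst|exact: cvg_snd].
- move=> s; apply: continuous_comp; last exact: cf.
  apply: continuous_pairing3 => t; [exact: cvg_fst|exact: cvg_snd|].
  by apply: cvgB; [exact: cvg_cst|exact: cvg_snd].
- exact: measurable_base_tri.
- by apply/seteqP; split=> s [/= h1 h2 h3]; split=> /=; lra.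
Qed.

Lemma tet_int_pd G : C1 G ->
  [/\ tet_int (pd 0 G) = ref_face_int 2 G - ref_face_int 1 G,
      tet_int (pd 1 G) = ref_face_int 0 G - ref_face_int 2 G &
      tet_int (pd 2 G) = ref_face_int 0 G - ref_face_int 3 G].
Proof.
move=> /[dup] CG [cG _]; split.
- rewrite tet_int_pd0// RintegralB//; last 3 first.
  + exact: measurable_ref_tri.
  + apply: integrable_ref_tri => s; apply: continuous_comp; last exact: cG.
    by apply: continuous_pairing3 => t; [exact: cvg_fst|exact: cvg_fst|exact: cvg_snd].
  + apply: integrable_ref_tri => s; apply: continuous_comp; last exact: cG.
    by apply: continuous_pairing3 => t; [exact: cvg_cst|exact: cvg_fst|exact: cvg_snd].
  by congr (_ - _); apply: eq_Rintegral => s _; have [_ E1 E2 _] := face_parE s;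
    rewrite ?E1 ?E2.
- rewrite tet_int_pd1//.
  transitivity (\int[leb2 R]_(s in @ref_tri R) G (s.1, 1 - s.2, s.2) - ref_face_int 2 G).
    rewrite RintegralB//; last 3 first.
    + exact: measurable_ref_tri.
    + apply: integrable_ref_tri => s; apply: continuous_comp; last exact: cG.
      apply: continuous_pairing3 => t; [exact: cvg_fst| |exact: cvg_snd].
      by apply: cvgB; [exact: cvg_cst|exact: cvg_snd].
    + apply: integrable_ref_tri => s; apply: continuous_comp; last exact: cG.
      by apply: continuous_pairing3 => t; [exact: cvg_fst|exact: cvg_fst|exact: cvg_snd].
    by congr (_ - _); apply: eq_Rintegral => s _; have [_ _ -> _] := face_parE s.
  congr (_ - _).
  rewrite (@preserves_tri (fun s => (1 - s.2 - s.1, s.2)) _ (fun s => G (s.1, 1 - s.2, s.2)))//.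
  + apply: eq_Rintegral => s _; have [-> _ _ _] := face_parE s.
    by congr (G (_, _, _)) => /=; ring.
  + exact: preserves_tri_reflect.
  + exact: continuous_tri_reflect.
  + move=> s; apply: continuous_comp; last exact: cG.
    apply: continuous_pairing3 => t; [exact: cvg_fst| |exact: cvg_snd].
    by apply: cvgB; [exact: cvg_cst|exact: cvg_snd].
  + exact: measurable_ref_tri.
  + exact: ref_tri_reflect.
- rewrite tet_int_pd2// -base_tri_shear// -base_tri_slanted// RintegralB//.
  + exact: measurable_base_tri.
  + apply: integrable_leb2; first exact: measurable_base_tri.
      by move=> s [h1 h2 h3]; split; rewrite /= in_itv /=; lra.
    move=> s; apply: continuous_comp; last exact: cG.
    apply: continuous_pairing3 => t; [exact: cvg_fst|exact: cvg_snd|].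
    by apply: cvgB; [exact: cvg_cst|exact: cvg_snd].
  + apply: integrable_leb2; first exact: measurable_base_tri.
      by move=> s [h1 h2 h3]; split; rewrite /= in_itv /=; lra.
    move=> s; apply: continuous_comp; last exact: cG.
    by apply: continuous_pairing3 => t; [exact: cvg_fst|exact: cvg_snd|exact: cvg_cst].
Qed.

End Green.

(** * Face integrals as integrals over the tetrahedron *)

Section GreenCone.
Context (R : realType).
Implicit Types (p q z : poly3 R) (j : 'I_3) (F : 'I_4) (G f g : R3 R -> R).

Lemma eq_tet_int f g : f =1 g -> tet_int f = tet_int g.
Proof. by move=> /funext ->. Qed.

Lemma ref_face_int_eqZ F (a : R) f g : continuous g ->
  (forall s, f (face_par F s) = a * g (face_par F s)) ->
  ref_face_int F f = a * ref_face_int F g.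
Proof.
move=> cg fg; rewrite -ref_face_intZ; last exact: continuous_face_integrable.
by apply: eq_Rintegral => s _; exact: fg.
Qed.

Lemma continuousM_fun f g : continuous f -> continuous g -> continuous (f * g).
Proof. by move=> cf cg x; apply: continuousM; [exact: cf|exact: cg]. Qed.

Let congr3_add (a b c a' b' c' : R) :
  a = a' -> b = b' -> c = c' -> a + b + c = a' + b' + c'.
Proof. by move=> -> -> ->. Qed.

(** The six face terms of the three coordinate directions, regrouped by face. *)
Let cone_formula_sum (a b c d e g' k m n r s t : R) :
  b = - m * n -> e = - k * g' -> a - c = r -> d + s = t ->
  (a - b) + (d - c) + (s - e) = r + m * n + t + k * g'.
Proof. by move=> -> -> <- <-; ring. Qed.

(* The divergence theorem for the field [G (x - v)]. *)
Lemma cone_formula G (v : R3 R) : C1 G ->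
  tet_int (fun x => \sum_(j < 3) pd j G x * (coord3 x j - coord3 v j) + 3 * G x) =
  (coord3 v 1 - coord3 v 0) * ref_face_int 2 G + coord3 v 0 * ref_face_int 1 G +
  (1 - coord3 v 1 - coord3 v 2) * ref_face_int 0 G + coord3 v 2 * ref_face_int 3 G.
Proof.
move=> CG.
pose P j : poly3 R := PX R j - mpolyC 3 (coord3 v j).
have PE j x : peval (P j) x = coord3 x j - coord3 v j.
  by rewrite pevalB peval_PX pevalC.
have CP j := C1_peval (P j).
have CH j := C1M CG (CP j).1.
pose H j := G * peval (P j).
have pdH j x : pd j (H j) x = pd j G x * (coord3 x j - coord3 v j) + G x.
  rewrite (CH j).2 !fctE (CP j).2 PE; congr (_ + _).
  rewrite /P mderivB mderivC subr0 mderivX mnm1E eqxx pevalZ mul1r.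
  have -> : mnm_sub (mnm1 j) (mnm1 j) = mnm0.
    by apply/mnmP => k; rewrite mnmBE subnn mnm0E.
  by rewrite mpolyX0 /peval meval1 mulr1.
have HE j x : H j x = G x * (coord3 x j - coord3 v j) by rewrite /H fctE PE.
have {}CH j : C1 (H j) by exact: (CH j).1.
have cH j : continuous (H j) by exact: (CH j).1.
have ipd j : tet_integrable (pd j (H j)).
  by apply: integrable_tet; exact: ((CH j).2 j).2.
clearbody H.
transitivity (tet_int (pd 0 (H 0)) + tet_int (pd 1 (H 1)) + tet_int (pd 2 (H 2))).
  rewrite -!tet_intD//; last exact: tet_integrableD.
  apply: eq_tet_int => x.
  rewrite sum_ord3 (pdH 0) (pdH 1) (pdH 2).
  move: (pd 0 G x) (pd 1 G x) (pd 2 G x) (G x) (coord3 x 0) (coord3 x 1) (coord3 x 2)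
    (coord3 v 0) (coord3 v 1) (coord3 v 2).
  by move=> *; ring.
have [E0 _ _] := tet_int_pd (CH 0).
have [_ E1 _] := tet_int_pd (CH 1).
have [_ _ E2] := tet_int_pd (CH 2).
apply: (etrans (congr3_add E0 E1 E2)).
have cG := CG.1.
have e1 : ref_face_int 1 (H 0) = - coord3 v 0 * ref_face_int 1 G.
  apply: ref_face_int_eqZ => // s; rewrite HE.
  have [_ -> _ _] := face_parE s.
  have [-> _ _] := coord3E (0, s.1, s.2); rewrite /=.
  by move: (coord3 _ _) (G _) => *; ring.
have e3 : ref_face_int 3 (H 2) = - coord3 v 2 * ref_face_int 3 G.
  apply: ref_face_int_eqZ => // s; rewrite HE.
  have [_ _ _ ->] := face_parE s.
  have [_ _ ->] := coord3E (s.1, s.1 + s.2, 0); rewrite /=.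
  by move: (coord3 _ _) (G _) => *; ring.
have e2 : ref_face_int 2 (H 0) - ref_face_int 2 (H 1) =
    (coord3 v 1 - coord3 v 0) * ref_face_int 2 G.
  rewrite -ref_face_intB; [|exact: continuous_face_integrable..].
  apply: ref_face_int_eqZ => // s; rewrite !HE.
  have [_ _ -> _] := face_parE s.
  have [-> -> _] := coord3E (s.1, s.1, s.2); rewrite /=.
  by move: (coord3 v 0) (coord3 v 1) (G _) => *; ring.
have e0 : ref_face_int 0 (H 1) + ref_face_int 0 (H 2) =
    (1 - coord3 v 1 - coord3 v 2) * ref_face_int 0 G.
  rewrite -ref_face_intD; [|exact: continuous_face_integrable..].
  apply: ref_face_int_eqZ => // s; rewrite !HE.
  have [-> _ _ _] := face_parE s.
  have [_ -> ->] := coord3E (1 - s.1 - s.2, 1 - s.2, s.2); rewrite /=.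
  by move: (coord3 v 1) (coord3 v 2) (G _) => *; ring.
exact: cone_formula_sum e1 e3 e2 e0.
Qed.

Lemma coord3_vtx F j : coord3 (vtx R F) j =
  nth 0 (nth [::] [:: [:: 0; 0; 0]; [:: 1; 1; 0]; [:: 0; 1; 0]; [:: 0; 0; 1]] F) j.
Proof.
rewrite /coord3 /vtx (tnth_nth 0) (tnth_nth (0, 0, 0)).
by move: F; apply: forall_ord4; move: j; apply: forall_ord3.
Qed.

(** The four coefficients in [cone_formula] are the barycentric coordinates of [v], so that taking
    [v] at a vertex retains the opposite face alone. *)
Lemma cone_formula_vtx F G : C1 G ->
  ref_face_int F G = tet_int (fun x =>
    \sum_(j < 3) pd j G x * (coord3 x j - coord3 (vtx R F) j) + 3 * G x).
Proof.
move=> CG; rewrite (cone_formula (vtx R F) CG).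
suff H (r : 'I_4 -> R) : r F = (coord3 (vtx R F) 1 - coord3 (vtx R F) 0) * r 2 +
    coord3 (vtx R F) 0 * r 1 +
    (1 - coord3 (vtx R F) 1 - coord3 (vtx R F) 2) * r 0 + coord3 (vtx R F) 2 * r 3.
  exact: (H (fun F' => ref_face_int F' G)).
rewrite !coord3_vtx; move: F; apply: forall_ord4;
  by rewrite /= ?(subr0, subrr, mul0r, add0r, addr0, mul1r).
Qed.

(* The field [z (x - v_F)] is tangent to the three other faces and has
   constant flux density along the face [F]. *)
Definition cone_field F z j : poly3 R := z * (PX R j - mpolyC 3 (coord3 (vtx R F) j)).
Definition cone_div F z : poly3 R := \sum_(j < 3) mderiv j (cone_field F z j).

(** A form of the trace relation between [u] and [g] that is stable under limits. It holds for [C1]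
    functions with their classical derivatives as well as for [H^1] functions with their weak
    derivatives and traces, so that integration by parts is proved once for both. *)
Definition green (u : R3 R -> R) (du : 'I_3 -> R3 R -> R) F (g : R3 R -> R) : Prop :=
  forall z, ref_face_int F (fun x => g x * peval z x) =
    tet_int (fun x => \sum_(j < 3) du j x * peval (cone_field F z j) x +
                      u x * peval (cone_div F z) x).

Lemma green_C1 f F : C1 f -> green f (fun j => pd j f) F f.
Proof.
move=> Cf z; have [Cz dz] := C1_peval z; have [CG dG] := C1M Cf Cz.
rewrite -[LHS]/(ref_face_int F (f * peval z)) cone_formula_vtx//.
apply: eq_tet_int => x.
have dE j : peval (mderiv j (cone_field F z j)) x =
    peval (mderiv j z) x * (coord3 x j - coord3 (vtx R F) j) + peval z x.
  rewrite /cone_field mderivM mderivB mderivC subr0 mderivX mnm1E eqxx.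
  have -> : mnm_sub (mnm1 j) (mnm1 j) = mnm0.
    by apply/mnmP => k; rewrite mnmBE subnn mnm0E.
  by rewrite mpolyX0 scale1r mulr1 pevalD pevalM pevalB peval_PX pevalC.
rewrite (eq_bigr (fun j => pd j f x * peval (cone_field F z j) x +
    f x * (peval (mderiv j z) x * (coord3 x j - coord3 (vtx R F) j)))); last first.
  move=> j _; rewrite dG dz !fctE /cone_field pevalM pevalB peval_PX pevalC.
  move: (pd j f x) (f x) (peval z x) (peval (mderiv j z) x) (coord3 x j) (coord3 _ j) => *.
  by ring.
rewrite big_split -mulr_sumr /= -addrA; congr (_ + _).
rewrite /cone_div peval_sum (eq_bigr _ (fun j _ => dE j)) big_split /= mulrDr.
by congr (_ + _); rewrite sumr_const card_ord mulr_natl mulrnAr.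
Qed.

End GreenCone.

(** * Square-integrable functions and traces *)

Section SquareIntegrable.
Context d (T : measurableType d) (R : realType) (mu : {measure set T -> \bar R}).
Context (D : set T) (mD : measurable D).
Implicit Types f g : T -> R.

(** A common form of [L2_tet] and [L2_face], which both unfold to it. *)
Definition L2on f : Prop := (f \_ D) \in Lfun mu 2%:E.
Definition L2on_norm f : R := fine ('N[mu]_2%:E [EFin \o (f \_ D)])%E.

Lemma patchM f g : (f \_ D) \* (g \_ D) = (f \* g) \_ D.
Proof. by apply/funext => x; rewrite /= !patchE; case: ifP; rewrite ?mulr0. Qed.

Lemma L2on_measurable f : L2on f -> measurable_fun setT (f \_ D).
Proof. by move=> /andP[/[!inE]/=]. Qed.

Lemma L2on_fin f : L2on f -> ('N[mu]_2%:E [EFin \o (f \_ D)])%E \is a fin_num.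
Proof.
by move=> /andP[_ /[!inE]/= h]; rewrite ge0_fin_numE// Lnorm_ge0.
Qed.

Lemma L2on_norm_ge0 f : 0 <= L2on_norm f.
Proof. exact/fine_ge0/Lnorm_ge0. Qed.

Lemma L2on_mul f g : L2on f -> L2on g -> mu.-integrable D (EFin \o (f \* g)).
Proof.
move=> lf lg; have /Lfun1_integrable := Lfun2_mul_Lfun1 lf lg.
by rewrite patchM -restrict_EFin => /(integrable_mkcond _ mD).
Qed.

Lemma L2on_mul_le f g : L2on f -> L2on g ->
  `|\int[mu]_(x in D) (f x * g x)| <= L2on_norm f * L2on_norm g.
Proof.
move=> lf lg; have ifg := L2on_mul lf lg.
apply: (le_trans (le_normr_Rintegral mD ifg)).
have mfg : measurable_fun D (f \* g).
  by apply/measurable_EFinP; exact: (measurable_int mu ifg).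
have fI : (\int[mu]_(x in D) (`|f x * g x|)%:E)%E \is a fin_num.
  by apply: integrable_fin_num => //; exact: (integrable_norm ifg).
rewrite /Rintegral -lee_fin EFinM !fineK ?L2on_fin//.
have h2 : (0 : R) < 2 by [].
have e2 : 2^-1 + 2^-1 = 1 :> R by rewrite [RHS]splitr !div1r.
have := @hoelder _ _ _ mu _ _ 2 2 (L2on_measurable lf) (L2on_measurable lg) h2 h2 e2.
apply: le_trans; rewrite Lnorm1.
rewrite integral_mkcond; apply: ge0_le_integral => //.
- by move=> x _; rewrite patchE; case: ifP.
- by apply/(measurable_restrict _ mD _) => //; rewrite setTI; apply/measurable_EFinP; apply: (measurableT_comp _ mfg).
- apply: measurableT_comp => //; apply/measurable_EFinP; apply: measurable_funM; exact: L2on_measurable.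
- move=> x _ /=.
  rewrite -[(f \_ D) x * (g \_ D) x]/(((f \_ D) \* (g \_ D)) x) patchM !patchE.
  by case: ifP => _ //=; rewrite normr0.
Qed.

Lemma L2on_powE f : (\int[mu]_x (`|(EFin \o (f \_ D)) x| `^ 2) =
  \int[mu]_x (((fun x => f x ^+ 2) \_ D) x)%:E)%E.
Proof.
apply: eq_integral => x _; transitivity ((`|(f \_ D) x| `^ 2)%:E).
  by rewrite -poweR_EFin.
rewrite powR_mulrn// real_normK ?num_real//.
by rewrite !patchE; case: ifP; rewrite // expr0n.
Qed.

Lemma L2on_norm_sqr f : L2on f -> L2on_norm f ^+ 2 = \int[mu]_(x in D) f x ^+ 2.
Proof.
move=> lf; rewrite -powR_mulrn ?L2on_norm_ge0// Rintegral_mkcond /Rintegral.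
apply: EFin_inj; rewrite -poweR_EFin fineK ?L2on_fin// poweR_Lnorm// L2on_powE fineK//.
apply: integrable_fin_num => //.
have := L2on_mul lf lf => /(integrable_mkcond _ mD).
by rewrite restrict_EFin.
Qed.

Lemma L2onI f : measurable_fun D f -> mu.-integrable D (EFin \o (fun x => f x ^+ 2)) ->
  L2on f.
Proof.
move=> mf if2; apply/andP; split.
  by rewrite inE /=; apply/(measurable_restrict _ mD _) => //; rewrite setTI.
rewrite inE /= /finite_norm unlock; apply: poweR_lty.
rewrite L2on_powE.
move: if2 => /(integrable_mkcond _ mD); rewrite restrict_EFin => h.
exact: (integrable_lty measurableT h).
Qed.

Lemma L2onB f g : L2on f -> L2on g -> L2on (f \- g).
Proof.
rewrite /L2on; have -> : (f \- g) \_ D = f \_ D - g \_ D.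
  by apply/funext => x; rewrite !fctE !patchE; case: ifP => _ //=; rewrite subr0.
have p1 : (1 <= 2%:E :> \bar R)%E by rewrite lee_fin ler1n.
move=> lf lg; have [_ hD] := Lfun_addr_closed mu p1.
by apply: hD => //; exact: Lfun_oppr_closed.
Qed.

End SquareIntegrable.

(** * Passage to the limit from smooth functions to [H^1] functions *)

Section SobolevGreen.
Context (R : realType).
Implicit Types (p q z : poly3 R) (j : 'I_3) (F : 'I_4) (f g : R3 R -> R).

Lemma smooth_C1 f : smooth f -> C1 f.
Proof. by move=> /(_ 1%N) [cf df]; split=> // i; have [d1 [c1 _]] := df i. Qed.

Lemma continuous_L2_tet f : continuous f -> L2_tet f.
Proof.
move=> cf; apply: (@L2onI _ _ _ (leb3 R) _ (@measurable_tet R)).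
  exact: measurable_funTS (continuous3_measurable cf).
apply: integrable_tet => x.
by apply: (@continuous_comp _ _ _ f (fun y => y ^+ 2)); [exact: cf|exact: exprn_continuous].
Qed.

Lemma continuous_L2_face F f : continuous f -> L2_face F f.
Proof.
move=> /(continuous_face (F := F)) cf; apply: (@L2onI _ _ _ (leb2 R) _ (@measurable_ref_tri R)).
  exact: measurable_funTS (continuous2_measurable cf).
apply: integrable_ref_tri => x.
by apply: (@continuous_comp _ _ _ (f \o face_par F) (fun y => y ^+ 2)); [exact: cf|exact: exprn_continuous].
Qed.

Lemma peval_L2_tet p : L2_tet (peval p).
Proof. exact/continuous_L2_tet/continuous_peval. Qed.

Lemma peval_L2_face F p : L2_face F (peval p).
Proof. exact/continuous_L2_face/continuous_peval. Qed.

Lemma L2_tet_mul f g : L2_tet f -> L2_tet g -> tet_integrable (fun x => f x * g x).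
Proof. exact: (@L2on_mul _ _ _ (leb3 R) _ (@measurable_tet R)). Qed.

Lemma L2_tetB f g : L2_tet f -> L2_tet g -> L2_tet (fun x => f x - g x).
Proof. exact: (@L2onB _ _ _ (leb3 R)). Qed.

Lemma tet_int_mul_le f g : L2_tet f -> L2_tet g ->
  `|tet_int (fun x => f x * g x)| <= L2norm f * L2norm g.
Proof. exact: (@L2on_mul_le _ _ _ (leb3 R) _ (@measurable_tet R)). Qed.

Lemma L2norm_ge0 f : 0 <= L2norm f.
Proof. exact/fine_ge0/Lnorm_ge0. Qed.

Lemma L2_face_mul F f g : L2_face F f -> L2_face F g ->
  face_integrable F (fun x => f x * g x).
Proof. exact: (@L2on_mul _ _ _ (leb2 R) _ (@measurable_ref_tri R)). Qed.

Lemma ref_face_int_mul_le F f g : L2_face F f -> L2_face F g ->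
  `|ref_face_int F (fun x => f x * g x)| <=
  Num.sqrt (ref_face_int F (fun x => f x ^+ 2)) *
  Num.sqrt (ref_face_int F (fun x => g x ^+ 2)).
Proof.
move=> lf lg.
have mT := @measurable_ref_tri R.
have E h : L2_face F h -> Num.sqrt (ref_face_int F (fun x => h x ^+ 2)) =
    L2on_norm (leb2 R) (@ref_tri R) (h \o face_par F).
  move=> lh; transitivity (Num.sqrt (L2on_norm (leb2 R) (@ref_tri R) (h \o face_par F) ^+ 2)).
    by rewrite (L2on_norm_sqr mT lh).
  by rewrite sqrtr_sqr ger0_norm// L2on_norm_ge0.
by rewrite !E//; exact: (@L2on_mul_le _ _ _ (leb2 R) _ mT (f \o face_par F) (g \o face_par F)).
Qed.

Lemma L2norm_le_H1 (u : R3 R -> R) (du : 'I_3 -> R3 R -> R) : L2norm u <= H1norm_of u du.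
Proof.
rewrite -[leLHS]ger0_norm ?L2norm_ge0// -sqrtr_sqr /H1norm_of ler_sqrt ?lerDl;
  by rewrite ?addr_ge0 ?sqr_ge0 ?sumr_ge0// => i _; rewrite sqr_ge0.
Qed.

Lemma L2norm_pd_le_H1 (u : R3 R -> R) (du : 'I_3 -> R3 R -> R) j : L2norm (du j) <= H1norm_of u du.
Proof.
rewrite -[leLHS]ger0_norm ?L2norm_ge0// -sqrtr_sqr /H1norm_of ler_sqrt; last first.
  by rewrite ?addr_ge0 ?sqr_ge0 ?sumr_ge0// => i _; rewrite sqr_ge0.
rewrite (bigD1 j) //= addrCA lerDl addr_ge0 ?sqr_ge0 ?sumr_ge0// => i _.
by rewrite sqr_ge0.
Qed.

Lemma face_jacE F : face_jac R F = Num.sqrt (nth 0 [:: 2; 1; 2; 1] F).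
Proof.
have e0 (i : 'I_4) (j : 'I_3) : face_vtx R i j =
    nth (0, 0, 0) [:: (0, 0, 0); (1, 1, 0); (0, 1, 0); (0, 0, 1)] (bump i j).
  by rewrite /face_vtx /vtx (tnth_nth (0, 0, 0)).
rewrite /face_jac /dot !sum_ord3 /coord3 !(tnth_nth 0) !e0.
congr Num.sqrt.
by move: F {e0}; apply: forall_ord4 => /=; ring.
Qed.

Lemma face_jac_gt0 F : 0 < face_jac R F.
Proof. by rewrite face_jacE sqrtr_gt0; move: F; apply: forall_ord4 => /=. Qed.

(** The constant that Cauchy-Schwarz gives when the face integral against [z] is bounded by the
    [H^1] norm. *)
Definition cone_norm F z : R :=
  \sum_(j < 3) L2norm (peval (cone_field F z j)) + L2norm (peval (cone_div F z)).

Lemma cone_norm_ge0 F z : 0 <= cone_norm F z.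
Proof. by rewrite addr_ge0 ?sumr_ge0 ?L2norm_ge0// => j _; rewrite L2norm_ge0. Qed.

Lemma cone_integrable (u : R3 R -> R) (du : 'I_3 -> R3 R -> R) F z :
  L2_tet u -> (forall j, L2_tet (du j)) ->
  tet_integrable (fun x => \sum_(j < 3) du j x * peval (cone_field F z j) x) /\
  tet_integrable (fun x => u x * peval (cone_div F z) x).
Proof.
move=> lu ldu; split; last by apply: L2_tet_mul => //; exact: peval_L2_tet.
rewrite (_ : (fun x => _) = (fun x => (du 0 x * peval (cone_field F z 0) x +
  du 1 x * peval (cone_field F z 1) x) + du 2 x * peval (cone_field F z 2) x)).
  by do 2?apply: tet_integrableD; apply: L2_tet_mul => //; exact: peval_L2_tet.
by apply/funext => x; rewrite sum_ord3.
Qed.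

Lemma cone_int_le (u : R3 R -> R) (du : 'I_3 -> R3 R -> R) F z (h : R) :
  L2_tet u -> (forall j, L2_tet (du j)) ->
  L2norm u <= h -> (forall j, L2norm (du j) <= h) ->
  `|tet_int (fun x => \sum_(j < 3) du j x * peval (cone_field F z j) x +
                      u x * peval (cone_div F z) x)| <= cone_norm F z * h.
Proof.
move=> lu ldu hu hdu.
have [i1 i2] := cone_integrable F z lu ldu.
rewrite tet_intD// (le_trans (ler_normD _ _))// mulrDl lerD//; last first.
  apply: (le_trans (tet_int_mul_le lu (peval_L2_tet _))).
  by rewrite mulrC ler_wpM2l ?L2norm_ge0.
pose w j x := du j x * peval (cone_field F z j) x.
have iw j : tet_integrable (w j) by apply: L2_tet_mul => //; exact: peval_L2_tet.
have -> : tet_int (fun x => \sum_(j < 3) du j x * peval (cone_field F z j) x) =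
    \sum_(j < 3) tet_int (w j).
  rewrite sum_ord3 -!tet_intD//; last exact: tet_integrableD.
  by apply: eq_tet_int => x; rewrite sum_ord3.
rewrite (le_trans (ler_norm_sum _ _ _))// mulr_suml ler_sum// => j _.
apply: (le_trans (tet_int_mul_le (ldu j) (peval_L2_tet _))).
by rewrite mulrC ler_wpM2l ?L2norm_ge0.
Qed.

(** Both sides are continuous, one for the [L^2] norm on the face and the other for the [H^1] norm,
    and they agree on the smooth approximations [phi m]. The defect for [u] is thus controlled by
    the two distances to [phi m]. *)
Lemma green_trace (u : H1space R) F g : is_trace F u g -> green u (wpd u) F g.
Proof.
move=> [lg [phi [sphi cH cg]]] z.
set lhs := LHS; set rhs := RHS; apply/eqP; rewrite -subr_eq0 -normr_le0.
pose e m := ref_face_int F (fun x => (phi m x - g x) ^+ 2).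
pose h m := H1norm_of (fun x => phi m x - u x)
                      (fun j x => pd j (phi m) x - wpd u j x).
pose c := Num.sqrt (ref_face_int F (fun x => peval z x ^+ 2)).
have ce : e @ \oo --> (0 : R).
  have -> : e = (fun m => (face_jac R F)^-1 * face_int F (fun x => (phi m x - g x) ^+ 2)).
    by apply/funext => m; rewrite /face_int mulKf// gt_eqF// face_jac_gt0.
  by rewrite -[X in _ --> X](mulr0 (face_jac R F)^-1); apply: cvgMr.
have cB : (fun m => Num.sqrt (e m) * c + cone_norm F z * h m) @ \oo --> (0 : R).
  have -> : 0 = Num.sqrt 0 * c + cone_norm F z * 0 :> R by rewrite sqrtr0 mul0r mulr0 addr0.
  apply: cvgD; last by apply: cvgMr.
  apply: cvgMl; apply: continuous_cvg => //; exact: sqrt_continuous.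
(* The defect does not depend on [m], so a bound valid for every [m] passes to the limit 0. *)
rewrite -(cvg_lim _ cB)//; apply: limr_ge; first by apply/cvg_ex; exists 0.
apply: nearW => m.
have Cm := smooth_C1 (sphi m).
have cm : continuous (phi m) by exact: Cm.1.
have lm := continuous_L2_tet cm.
have ldm j : L2_tet (pd j (phi m)) by exact: continuous_L2_tet (Cm.2 j).2.
have G := green_C1 F Cm z.
have E1 : lhs = ref_face_int F (fun x => phi m x * peval z x) -
    ref_face_int F (fun x => (phi m x - g x) * peval z x).
  rewrite -ref_face_intB.
  - by apply: eq_Rintegral => s _; ring.
  - by apply: continuous_face_integrable; apply: continuousM_fun => //; exact: continuous_peval.
  - apply: L2_face_mul; last exact: peval_L2_face.
    by apply: (@L2onB _ _ _ (leb2 R) _ (phi m \o face_par F) (g \o face_par F)) => //;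
      exact: continuous_L2_face.
have [i1 i2] := cone_integrable F z lm ldm.
have [i3 i4] := cone_integrable F z (H1val_L2 u) (wpd_L2 u).
pose P x := \sum_(j < 3) pd j (phi m) x * peval (cone_field F z j) x +
  phi m x * peval (cone_div F z) x.
pose Q x := \sum_(j < 3) (pd j (phi m) x - wpd u j x) * peval (cone_field F z j) x +
  (phi m x - u x) * peval (cone_div F z) x.
have E2 : tet_int Q = tet_int P - rhs.
  rewrite /rhs -tet_intB; [|exact: tet_integrableD..].
  apply: eq_tet_int => x; rewrite /Q /P mulrBl.
  rewrite (eq_bigr (fun j => pd j (phi m) x * peval (cone_field F z j) x -
    wpd u j x * peval (cone_field F z j) x)); last by move=> j _; rewrite mulrBl.
  rewrite sumrB; move: (\sum_(j < 3) _) (\sum_(j < 3) _) (phi m x * _) (u x * _) => *.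
  by ring.
have -> : lhs - rhs = tet_int Q -
    ref_face_int F (fun x => (phi m x - g x) * peval z x).
  rewrite E1 G -/P E2; move: (tet_int P) (ref_face_int _ _) => a b.
  by rewrite [RHS]addrAC.
rewrite (le_trans (ler_normB _ _))// addrC lerD//.
  apply: (le_trans (ref_face_int_mul_le _ (peval_L2_face F z))) => //.
  by apply: (@L2onB _ _ _ (leb2 R) _ (phi m \o face_par F) (g \o face_par F)) => //;
      exact: continuous_L2_face.
apply: cone_int_le.
- by apply: L2_tetB => //; exact: H1val_L2.
- by move=> j; apply: L2_tetB => //; exact: wpd_L2.
- exact: L2norm_le_H1.
- move=> j; exact: (@L2norm_pd_le_H1 _ (fun j x => pd j (phi m) x - wpd u j x)).
Qed.

End SobolevGreen.

(** * Polynomial algebra *)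

Section PolynomialAlgebra.
Context (R : realType).
Implicit Types (p q r a : poly3 R) (i j : 'I_3) (d e : nat).

Lemma msize_leP p d : reflect (forall m, (d <= mdeg m)%N -> mcoeff m p = 0) (msize p <= d)%N.
Proof.
apply: (iffP idP) => [pd m dm|H].
  by apply/memN_msupp_eq0/msize_mdeg_ge/(leq_trans pd).
rewrite msizeE; apply/bigmax_leqP_seq => m; rewrite mcoeff_msupp => pm _.
by rewrite ltnNge; apply: contra pm => /H ->.
Qed.

Lemma msizeD_leq p q d : (msize p <= d)%N -> (msize q <= d)%N -> (msize (p + q) <= d)%N.
Proof. by move=> pd qd; rewrite (leq_trans (mmeasureD_le _ _ _))// geq_max pd. Qed.

Lemma msizeN_leq p d : (msize p <= d)%N -> (msize (- p) <= d)%N.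
Proof. by rewrite -scaleN1r; apply: leq_trans; exact: msizeZ_le. Qed.

Lemma msizeB_leq p q d : (msize p <= d)%N -> (msize q <= d)%N -> (msize (p - q) <= d)%N.
Proof. by move=> pd qd; rewrite msizeD_leq ?msizeN_leq. Qed.

Lemma msizeM_leq p q : (msize (p * q) <= (msize p + msize q).-1)%N.
Proof.
have [->|p0] := eqVneq p 0; first by rewrite mul0r msize0.
have [->|q0] := eqVneq q 0; first by rewrite mulr0 msize0.
by rewrite msizeM.
Qed.

Lemma msizeC_leq c d : (msize (mpolyC 3 c : poly3 R) <= d.+1)%N.
Proof.
apply/msize_leP => m dm; rewrite mcoeffC; case: eqP => [m0|_]; last by rewrite mulr0.
by move: dm; rewrite m0 mdeg0.
Qed.

Lemma msize_PX i : msize (PX R i) = 2.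
Proof. by rewrite msizeX mdeg1. Qed.

Lemma msize_PXM i p d : (msize p <= d)%N -> (msize (PX R i * p) <= d.+1)%N.
Proof.
move=> pd; rewrite (leq_trans (msizeM_leq _ _))// msize_PX addSn /= add1n.
by rewrite ltnS.
Qed.

Lemma msize_sum_leq (I : eqType) (s : seq I) (F : I -> poly3 R) d :
  (forall x, x \in s -> (msize (F x) <= d)%N) -> (msize (\sum_(x <- s) F x) <= d)%N.
Proof.
move=> H; rewrite big_seq; apply: (big_ind (fun p => (msize p <= d)%N)) => //.
  by rewrite msize0.
by move=> x y; exact: msizeD_leq.
Qed.

Lemma mnm_add1K (m : multinom 3) i : (0 < m i)%N ->
  m = mnm_add (mnm1 i) (mnm_sub m (mnm1 i)).
Proof.
move=> mi; apply/mnmP => k; rewrite mnmDE mnmBE mnm1E.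
by case: eqP => [<-|_]; rewrite ?subn0// subnKC.
Qed.

Lemma mnm_gt0 (m : multinom 3) : m <> mnm0 -> exists i, (0 < m i)%N.
Proof.
move=> m0; apply: contrapT => H; apply: m0; apply/mnmP => i.
by rewrite mnm0E; case: (posnP (m i)) => // mi; case: H; exists i.
Qed.

(** The degree bound is an argument of the predicate and grows with each variable multiplied in,
    which lets statements with degree control go through an induction on polynomials. *)
Lemma mpoly_deg_ind (Q : nat -> poly3 R -> Prop) :
  (forall d c, Q d (mpolyC 3 c)) ->
  (forall d p q, Q d p -> Q d q -> Q d (p + q)) ->
  (forall d i p, Q d p -> Q d.+1 (PX R i * p)) ->
  forall d p, (msize p <= d.+1)%N -> Q d p.
Proof.
move=> QC QD QX.
have Qm n : forall (m : multinom 3) c d, mdeg m = n -> (n <= d)%N -> Q d (c *: mpolyX R m).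
  elim: n => [m c d /eqP|n IH m c [//|d] mn nd].
    by rewrite mdeg_eq0 => /eqP -> _; rewrite mpolyX0 -mul_mpolyC mulr1.
  have [i mi] : exists i, (0 < m i)%N.
    by apply: mnm_gt0 => m0; move: mn; rewrite m0 mdeg0.
  rewrite (mnm_add1K mi) mpolyXD scalerAr; apply: QX; apply: IH => //.
  by move: mn; rewrite {1}(mnm_add1K mi) mdegD mdeg1 add1n => -[].
move=> d p pd; rewrite [p]mpolyE big_seq.
apply: (big_ind (Q d)) => [||m]; [by rewrite -mpolyC0|exact: QD|].
by move=> /msize_mdeg_lt mp; apply: Qm => //; rewrite -ltnS (leq_trans mp).
Qed.

Definition subst j a p : poly3 R :=
  comp_mpoly [tuple (if i == j then a else PX R i) | i < 3] p.

Lemma substD j a p q : subst j a (p + q) = subst j a p + subst j a q.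
Proof. exact: comp_mpolyD. Qed.
Lemma substM j a p q : subst j a (p * q) = subst j a p * subst j a q.
Proof. exact: rmorphM. Qed.
Lemma substC j a c : subst j a (mpolyC 3 c) = mpolyC 3 c.
Proof. exact: comp_mpolyC. Qed.
Lemma substX j a i : subst j a (PX R i) = if i == j then a else PX R i.
Proof. by rewrite /subst comp_mpolyXU -tnth_nth tnth_mktuple. Qed.

Lemma peval_subst j a p (x y : R3 R) :
  (forall i, coord3 y i = if i == j then peval a x else coord3 x i) ->
  peval (subst j a p) x = peval p y.
Proof.
move=> yE; rewrite /peval comp_mpoly_meval; apply: meval_eq => i.
by rewrite tnth_mktuple yE; case: ifP => // _; rewrite -peval_PX.
Qed.

Lemma msize_subst j a d p : (msize a <= 2)%N -> (msize p <= d.+1)%N ->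
  (msize (subst j a p) <= d.+1)%N.
Proof.
move=> a2; move: d p; apply: mpoly_deg_ind => [d c|d p q pd qd|d i p pd].
- by rewrite substC msizeC_leq.
- by rewrite substD msizeD_leq.
rewrite substM substX; case: ifP => _; last exact: msize_PXM.
rewrite (leq_trans (msizeM_leq _ _))//.
by rewrite -subn1 leq_subLR (leq_trans (leq_add a2 pd)).
Qed.

Lemma mderiv_PX i j : mderiv i (PX R j) = mpolyC 3 (i == j)%:R.
Proof.
rewrite /PX mderivX mnm1E eq_sym; case: eqP => [->|_]; last by rewrite scale0r mpolyC0.
have -> : mnm_sub (mnm1 j) (mnm1 j) = mnm0.
  by apply/mnmP => k; rewrite mnmBE subnn mnm0E.
by rewrite scale1r mpolyX0 mpolyC1.
Qed.

Lemma mderiv_subst j a p : mderiv j a = 0 -> mderiv j (subst j a p) = 0.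
Proof.
move=> a0; elim/mpoly_ring_ind: p => [c|i|p q dp dq|p q dp dq].
- by rewrite substC mderivC.
- rewrite -/(PX R i) substX; case: ifPn => // ij.
  by rewrite mderiv_PX eq_sym (negbTE ij) mpolyC0.
- by rewrite substD mderivD dp dq addr0.
- by rewrite substM mderivM dp dq mul0r mulr0 addr0.
Qed.

(** The factor theorem for the variable [j], with the loss of one degree in the quotient. *)
Lemma subst_factor j a d p : (msize a <= 2)%N -> (msize p <= d.+1)%N ->
  exists2 r, (msize r <= d)%N & p - subst j a p = (PX R j - a) * r.
Proof.
(* The bound on [p] joins the induction predicate because the quotient for [X_j p] contains
   [subst j a p], whose size must be known. *)
move=> a2 pd; suff: (msize p <= d.+1)%N /\
    exists2 r, (msize r <= d)%N & p - subst j a p = (PX R j - a) * r by case.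
move: d p pd; apply: mpoly_deg_ind => [d c|d p q [pd [r rd E]] [qd [s sd E']]|d i p [pd [r rd E]]].
- split; first exact: msizeC_leq.
  by exists 0; rewrite ?msize0// substC subrr mulr0.
- split; first exact: msizeD_leq.
  exists (r + s); first exact: msizeD_leq.
  by rewrite substD mulrDr -E -E'; ring.
split; first exact: msize_PXM.
have sE : p = subst j a p + (PX R j - a) * r by rewrite -E addrC subrK.
rewrite substM substX; case: eqP => [->|_].
  (* With [s] for [subst j a p], this is [X_j p - a s = X_j (p - s) + (X_j - a) s]. *)
  exists (PX R j * r + subst j a p).
    by apply: msizeD_leq; [exact: msize_PXM|exact: msize_subst].
  by rewrite {1}sE; ring.
exists (PX R i * r); first exact: msize_PXM.
by rewrite {1}sE; ring.
Qed.

Lemma primitive j d p : (msize p <= d)%N ->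
  exists2 q, (msize q <= d.+1)%N & mderiv j q = p.
Proof.
move=> pd.
exists (\sum_(m <- msupp p) (mcoeff m p / (m j).+1%:R) *: mpolyX R (mnm_add m (mnm1 j))).
  apply: msize_sum_leq => m /msize_mdeg_lt mp.
  rewrite (leq_trans (msizeZ_le _ _))// msizeX mdegD mdeg1 addn1 !ltnS.
  exact: leq_trans mp pd.
rewrite raddf_sum /= [RHS]mpolyE; apply: eq_bigr => m _.
rewrite mderivZ mderivX mnmDE mnm1E eqxx addn1 scalerA divfK ?pnatr_eq0//.
congr (_ *: mpolyX _ _).
by apply/mnmP => k; rewrite mnmBE mnmDE addnK.
Qed.

Lemma msize_mderiv i d p : (msize p <= d.+1)%N -> (msize (mderiv i p) <= d)%N.
Proof.
move=> /msize_leP pd; apply/msize_leP => m dm.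
by rewrite mcoeff_mderiv pd ?mul0rn// mdegD mdeg1 addn1 ltnS.
Qed.

Lemma mderiv_eq0 p : (forall i, mderiv i p = 0) -> p = mpolyC 3 (mcoeff mnm0 p).
Proof.
move=> dp; apply/mpolyP => m; rewrite mcoeffC; have [->|m0] := eqVneq m mnm0.
  by rewrite mulr1.
rewrite mulr0.
have [i mi] := mnm_gt0 (elimN eqP m0).
have := congr1 (mcoeff (mnm_sub m (mnm1 i))) (dp i).
rewrite mcoeff_mderiv mcoeff0 => /eqP; rewrite mulrn_eq0 /= => /eqP <-.
by congr (mcoeff _ p); rewrite {1}(mnm_add1K mi) addmC.
Qed.

Lemma mderiv_zero_near i p (x : R3 R) : (\forall y \near x, peval p y = 0) ->
  peval (mderiv i p) x = 0.
Proof.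
move=> p0; rewrite -(C1_peval p).2 /pd.
rewrite (@near_eq_derive _ _ _ (peval p) (cst 0))//; exact: derive_cst.
Qed.

(** By induction on the degree: the partial derivatives vanish on [U] as well, hence are zero
    polynomials, so [p] is a constant that vanishes at a point. *)
Lemma peval_open_eq0 (U : set (R3 R)) p : open U -> U !=set0 ->
  (forall x, U x -> peval p x = 0) -> p = 0.
Proof.
move=> oU [x0 Ux0].
have [d] := ubnP (msize p); elim: d p => // d IH p pd p0.
have dp i : mderiv i p = 0.
  have [->|pN0] := eqVneq p 0; first by rewrite mderiv0.
  have spos : (0 < msize p)%N by rewrite lt0n msize_poly_eq0.
  apply: IH.
    rewrite (@leq_ltn_trans (msize p).-1) ?prednK//.
    by apply: msize_mderiv; rewrite prednK.
  move=> x Ux; apply: mderiv_zero_near.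
  by near=> y; apply: p0; near: y; exact: open_nbhs_nbhs.
rewrite (mderiv_eq0 dp); have := p0 _ Ux0.
by rewrite {1}(mderiv_eq0 dp) pevalC => ->; rewrite mpolyC0.
Unshelve. all: by end_near. Qed.

Lemma euler_mnm (m : multinom 3) :
  \sum_(i < 3) mderiv i (mpolyX R m) * PX R i = (mdeg m)%:R *: mpolyX R m.
Proof.
rewrite (eq_bigr (fun i : 'I_3 => (m i)%:R *: mpolyX R m)).
  by rewrite -scaler_suml -natr_sum mdegE.
move=> i _; rewrite mderivX -scalerAl; have [->|mi] := posnP (m i).
  by rewrite !scale0r.
by congr (_ *: _); rewrite mulrC -mpolyXD -mnm_add1K.
Qed.

(* A potential whose radial derivative is [z . x]: this splits off a gradient
   from any field, leaving a field orthogonal to [x]. *)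
Lemma euler_decomposition d (z : 'I_3 -> poly3 R) :
  (forall i, (msize (z i) <= d.+1)%N) ->
  exists2 q, (msize q <= d.+2)%N & \sum_(i < 3) (z i - mderiv i q) * PX R i = 0.
Proof.
move=> zd.
pose q := \sum_(j < 3) \sum_(m <- msupp (z j))
  (mcoeff m (z j) / (mdeg m).+1%:R) *: mpolyX R (mnm_add m (mnm1 j)).
exists q.
  apply: msize_sum_leq => j _; apply: msize_sum_leq => m /msize_mdeg_lt mz.
  rewrite (leq_trans (msizeZ_le _ _))// msizeX mdegD mdeg1 addn1 !ltnS.
  by rewrite -ltnS (leq_trans mz).
under eq_bigr do rewrite mulrBl.
rewrite sumrB; apply/eqP; rewrite subr_eq0; apply/eqP.
transitivity (\sum_(j < 3) \sum_(m <- msupp (z j))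
    \sum_(i < 3) mderiv i ((mcoeff m (z j) / (mdeg m).+1%:R) *: mpolyX R (mnm_add m (mnm1 j))) * PX R i).
  apply: eq_bigr => j _; rewrite [X in X * _]mpolyE mulr_suml; apply: eq_bigr => m _.
  under eq_bigr do rewrite mderivZ -scalerAl.
  rewrite -scaler_sumr euler_mnm mdegD mdeg1 addn1 scalerA divfK ?pnatr_eq0//.
  by rewrite mpolyXD -scalerAl.
rewrite /q (eq_bigr (fun j => \sum_(i < 3) \sum_(m <- msupp (z j))
    mderiv i ((mcoeff m (z j) / (mdeg m).+1%:R) *: mpolyX R (mnm_add m (mnm1 j))) * PX R i)); last first.
  by move=> j _; rewrite exchange_big.
rewrite exchange_big /=; apply: eq_bigr => i _.
rewrite raddf_sum mulr_suml; apply: eq_bigr => j _ /=.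
by rewrite raddf_sum mulr_suml.
Qed.

End PolynomialAlgebra.

(** * Pairing with the degrees of freedom *)

Section Pairing.
Context (R : realType).
Implicit Types (p q z a : poly3 R) (i j l : 'I_3) (F : 'I_4).

(** The outward unit normal times [face_jac]. It is also minus the gradient of the barycentric
    coordinate of the vertex opposite to the face. *)
Definition area_normal F j : R :=
  nth 0 (nth [::] [:: [:: 0; 1; 1]; [:: -1; 0; 0]; [:: 1; -1; 0]; [:: 0; 0; -1]] F) j.

Lemma tet_int_sum (I : Type) (s : seq I) (f : I -> R3 R -> R) :
  (forall k, tet_integrable (f k)) ->
  tet_integrable (fun x => \sum_(k <- s) f k x) /\
  tet_int (fun x => \sum_(k <- s) f k x) = \sum_(k <- s) tet_int (f k).
Proof.
move=> fi; elim: s => [|k s [IH1 IH2]].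
  rewrite (_ : (fun x => _) = cst 0); last by apply/funext => x; rewrite big_nil.
  split; first by apply: integrable_tet => x; exact: cvg_cst.
  by rewrite big_nil /tet_int /Rintegral integral0.
rewrite (_ : (fun x => _) = (fun x => f k x + \sum_(k <- s) f k x)); last first.
  by apply/funext => x; rewrite big_cons.
by split; [exact: tet_integrableD|rewrite tet_intD// IH2 big_cons].
Qed.

Lemma tet_integrableZ (c : R) (f : R3 R -> R) : tet_integrable f ->
  tet_integrable (fun x => c * f x).
Proof. by move=> fi; exact: (integrableZl (@measurable_tet R) c fi). Qed.

(** The barycentric coordinates sum to 1 and reproduce the point as a combination of the vertices;
    taking gradients of these two identities gives [s0] and [s1]. *)
Lemma area_normal_cone j l z :
  \sum_(F < 4) area_normal F j *: cone_field F z l = (j == l)%:R *: z.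
Proof.
have s0 : \sum_(F < 4) area_normal F j = 0.
  by rewrite sum_ord4 /area_normal; move: j; apply: forall_ord3 => /=; ring.
have s1 : \sum_(F < 4) area_normal F j * coord3 (vtx R F) l = - (j == l)%:R.
  rewrite sum_ord4 !coord3_vtx /area_normal; move: j {s0}; apply: forall_ord3; move: l;
    apply: forall_ord3 => /=; ring.
rewrite (eq_bigr (fun F => area_normal F j *: (z * PX R l) -
    (area_normal F j * coord3 (vtx R F) l) *: z)); last first.
  move=> F _; rewrite /cone_field mulrBr scalerBr; congr (_ - _).
  by rewrite mulrC mul_mpolyC scalerA.
by rewrite sumrB -!scaler_suml s0 s1 scale0r add0r scaleNr opprK.
Qed.

(** On a face of this kind every polynomial coincides with one of no larger degree that is
    independent of [x_j]. *)
Definition graph j F a : Prop :=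
  [/\ (msize a <= 2)%N, mderiv j a = 0 &
      forall s, coord3 (face_par F s) j = peval a (face_par F s)].

(** These are the faces opposite to the two ends of the edge parallel to [e_j]: lines in the
    direction [e_j] enter through [Fm] and leave through [Fp]. *)
Lemma graph_faces j : exists Fm Fp am ap,
  [/\ graph j Fm am, graph j Fp ap &
      forall r : 'I_4 -> R, \sum_(F < 4) area_normal F j * r F = r Fp - r Fm].
Proof.
have mX i : (msize (PX R i) <= 2)%N by rewrite msize_PX.
have m0 : (msize (0 : poly3 R) <= 2)%N by rewrite msize0.
have m1X i : (msize (1 - PX R i) <= 2)%N.
  by apply: msizeB_leq => //; rewrite -mpolyC1 msizeC_leq.
have dX i l : i != l -> mderiv i (PX R l) = 0.
  by move=> /negbTE il; rewrite mderiv_PX il mpolyC0.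
have d1X i l : i != l -> mderiv i (1 - PX R l) = 0.
  by move=> il; rewrite mderivB -mpolyC1 mderivC dX// subr0.
move: j; apply: forall_ord3.
- exists 1, 2, 0, (PX R 1); split.
  + split => //; first exact: mderiv0.
    by move=> s; rewrite peval0; have [_ -> _ _] := face_parE s; have [-> _ _] := coord3E (0, s.1, s.2).
  + split => //; first exact: dX.
    by move=> s; rewrite peval_PX; have [_ _ -> _] := face_parE s; have [-> -> _] := coord3E (s.1, s.1, s.2).
  + by move=> r; rewrite sum_ord4 /area_normal /=; move: (r 0) (r 1) (r 2) (r 3) => *; ring.
- exists 2, 0, (PX R 0), (1 - PX R 2); split.
  + split => //; first exact: dX.
    by move=> s; rewrite peval_PX; have [_ _ -> _] := face_parE s; have [-> -> _] := coord3E (s.1, s.1, s.2).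
  + split => //; first exact: d1X.
    move=> s; rewrite pevalB peval_PX -mpolyC1 pevalC; have [-> _ _ _] := face_parE s.
    by have [_ -> ->] := coord3E (1 - s.1 - s.2, 1 - s.2, s.2).
  + by move=> r; rewrite sum_ord4 /area_normal /=; move: (r 0) (r 1) (r 2) (r 3) => *; ring.
- exists 3, 0, 0, (1 - PX R 1); split.
  + split => //; first exact: mderiv0.
    by move=> s; rewrite peval0; have [_ _ _ ->] := face_parE s; have [_ _ ->] := coord3E (s.1, s.1 + s.2, 0).
  + split => //; first exact: d1X.
    move=> s; rewrite pevalB peval_PX -mpolyC1 pevalC; have [-> _ _ _] := face_parE s.
    have [_ -> ->] := coord3E (1 - s.1 - s.2, 1 - s.2, s.2) => /=.
    by move: (s.2) => *; ring.
  + by move=> r; rewrite sum_ord4 /area_normal /=; move: (r 0) (r 1) (r 2) (r 3) => *; ring.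
Qed.

Lemma graph_subst j F a p s : graph j F a ->
  peval (subst j a p) (face_par F s) = peval p (face_par F s).
Proof.
move=> [_ _ aE]; apply: peval_subst => i; case: eqP => [->|//].
exact: aE.
Qed.

Section GreenData.
Variables (u : R3 R -> R) (du : 'I_3 -> R3 R -> R) (g : 'I_4 -> R3 R -> R).

Definition green_data : Prop :=
  [/\ L2_tet u, forall j, L2_tet (du j), forall F, L2_face F (g F) &
      forall F, green u du F (g F)].

(** With the weights [area_normal F j], the cone fields of the four faces add up to [z e_j], so that
    every derivative except [du j] cancels. *)
Lemma green_ibp j z : green_data ->
  \sum_(F < 4) area_normal F j * ref_face_int F (fun x => g F x * peval z x) =
  tet_int (fun x => du j x * peval z x) + tet_int (fun x => u x * peval (mderiv j z) x).
Proof.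
move=> [lu ldu lg G].
pose K F x := \sum_(l < 3) du l x * peval (cone_field F z l) x + u x * peval (cone_div F z) x.
have iK F : tet_integrable (K F).
  by have [? ?] := cone_integrable F z lu ldu; exact: tet_integrableD.
transitivity (\sum_(F < 4) tet_int (fun x => area_normal F j * K F x)).
  by apply: eq_bigr => F _; rewrite G tet_intZ//; exact: iK.
have iaK F : tet_integrable (fun x => area_normal F j * K F x) by exact: tet_integrableZ.
rewrite -(tet_int_sum _ iaK).2 -tet_intD; last 2 first.
- by apply: L2_tet_mul => //; exact: peval_L2_tet.
- by apply: L2_tet_mul => //; exact: peval_L2_tet.
apply: eq_tet_int => x.
rewrite /K; under eq_bigr do rewrite mulrDr mulr_sumr.
rewrite big_split /= exchange_big /=; congr (_ + _).
  rewrite (eq_bigr (fun l => du l x * ((j == l)%:R * peval z x))).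
    rewrite (bigD1 j)//= eqxx mul1r big1 ?addr0// => l.
    by rewrite eq_sym => /negbTE ->; rewrite mul0r mulr0.
  move=> l _; rewrite -pevalZ -area_normal_cone peval_sum mulr_sumr.
  by apply: eq_bigr => F _; rewrite pevalZ mulrCA.
under eq_bigr do rewrite mulrCA -pevalZ.
rewrite -mulr_sumr -peval_sum; congr (_ * peval _ x).
rewrite /cone_div; under eq_bigr do rewrite scaler_sumr.
rewrite exchange_big /= (eq_bigr (fun l => mderiv l ((j == l)%:R *: z))).
  rewrite (bigD1 j)//= eqxx scale1r big1 ?addr0// => l.
  by rewrite eq_sym => /negbTE ->; rewrite scale0r mderiv0.
move=> l _; rewrite -area_normal_cone raddf_sum /=.
by apply: eq_bigr => F _; rewrite mderivZ.
Qed.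

End GreenData.

(** The share of the component [j], given by [u] with traces [g], in the sum of the degrees of
    freedom with face data [zF] and interior data [z]. *)
Definition pair j (u : R3 R -> R) (g : 'I_4 -> R3 R -> R)
    (zF : 'I_4 -> poly3 R) (z : 'I_3 -> poly3 R) : R :=
  \sum_(F < 4) area_normal F j * ref_face_int F (fun x => g F x * peval (zF F) x) +
  tet_int (fun x => u x * peval (z j) x).

Lemma green_data_peval p :
  green_data (peval p) (fun j => peval (mderiv j p)) (fun=> peval p).
Proof.
have [Cp dp] := C1_peval p; split.
- exact: peval_L2_tet.
- by move=> j; exact: peval_L2_tet.
- by move=> F; exact: peval_L2_face.
move=> F; have := green_C1 F Cp.
by rewrite (_ : (fun j => pd j (peval p)) = (fun j => peval (mderiv j p)))//; apply/funext.
Qed.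

Lemma green_data_H1 (u : H1space R) (g : 'I_4 -> R3 R -> R) :
  (forall F, is_trace F u (g F)) -> green_data u (wpd u) g.
Proof.
move=> tr; split; [exact: H1val_L2|exact: wpd_L2|by move=> F; have [] := tr F|].
by move=> F; exact: green_trace.
Qed.

Lemma pair_H1_bound i (zF : 'I_4 -> poly3 R) (z : 'I_3 -> poly3 R) :
  exists2 C, 0 <= C & forall (u : H1space R) g, (forall F, is_trace F u (g F)) ->
    `|pair i u g zF z| <= C * H1norm u.
Proof.
exists (\sum_(F < 4) `|area_normal F i| * cone_norm F (zF F) + L2norm (peval (z i))).
  rewrite addr_ge0 ?L2norm_ge0// sumr_ge0// => F _.
  by rewrite mulr_ge0 ?normr_ge0 ?cone_norm_ge0.
move=> u g tr; rewrite /pair (le_trans (ler_normD _ _))// mulrDl lerD//; last first.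
  apply: (le_trans (tet_int_mul_le (H1val_L2 u) (peval_L2_tet _))).
  by rewrite mulrC ler_wpM2l ?L2norm_ge0 ?L2norm_le_H1.
rewrite (le_trans (ler_norm_sum _ _ _))// mulr_suml ler_sum// => F _.
rewrite normrM -mulrA ler_wpM2l// (green_trace (tr F)).
apply: cone_int_le; [exact: H1val_L2|exact: wpd_L2|exact: L2norm_le_H1|].
by move=> j; exact: L2norm_pd_le_H1.
Qed.

(* Along the direction [e_j] the tetrahedron lies between the graphs of two
   faces. Moving the test data to an antiderivative [zeta] of [- z_j] which
   matches the data of the lower face leaves a mismatch [m] on the upper face,
   independent of [x_j], and the hypothesis for [p = m] makes it vanish. *)
Lemma pair_deriv_bound j d (zF : 'I_4 -> poly3 R) (z : 'I_3 -> poly3 R) :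
  (forall F, (msize (zF F) <= d.+1)%N) -> (msize (z j) <= d)%N ->
  (forall p, (msize p <= d.+1)%N -> mderiv j p = 0 ->
    pair j (peval p) (fun=> peval p) zF z = 0) ->
  exists2 C, 0 <= C & forall (u : H1space R) g, (forall F, is_trace F u (g F)) ->
    `|pair j u g zF z| <= C * L2norm (wpd u j).
Proof.
move=> zFd zd H0.
have [Fm [Fp [am [ap [gm gp sumE]]]]] := graph_faces j.
have [A Ad dA] := primitive j zd.
have [am2 dam _] := gm; have [ap2 dap _] := gp.
pose zeta := subst j am (zF Fm + A) - A.
have zetad : (msize zeta <= d.+1)%N.
  by apply: msizeB_leq => //; apply: msize_subst => //; exact: msizeD_leq.
have dzeta : mderiv j zeta = - z j by rewrite mderivB mderiv_subst// dA add0r.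
have zetam s : peval zeta (face_par Fm s) = peval (zF Fm) (face_par Fm s).
  by rewrite pevalB (graph_subst _ _ gm) pevalD addrK.
pose m := subst j ap (zF Fp - zeta).
have md : (msize m <= d.+1)%N by apply: msize_subst => //; exact: msizeB_leq.
have dm : mderiv j m = 0 by exact: mderiv_subst.
have mE s : peval m (face_par Fp s) =
    peval (zF Fp) (face_par Fp s) - peval zeta (face_par Fp s).
  by rewrite (graph_subst _ _ gp) pevalB.
have pairE u du g : green_data u du g -> pair j u g zF z =
    ref_face_int Fp (fun x => g Fp x * peval m x) + tet_int (fun x => du j x * peval zeta x).
  move=> G; have := green_ibp j zeta G; have [lu ldu lg _] := G.
  rewrite /pair !sumE dzeta => E.
  have -> : ref_face_int Fm (fun x => g Fm x * peval (zF Fm) x) =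
      ref_face_int Fm (fun x => g Fm x * peval zeta x).
    by apply: eq_Rintegral => s _; rewrite zetam.
  have -> : ref_face_int Fp (fun x => g Fp x * peval m x) =
      ref_face_int Fp (fun x => g Fp x * peval (zF Fp) x) -
      ref_face_int Fp (fun x => g Fp x * peval zeta x).
    rewrite -ref_face_intB; last 2 first.
    - by apply: L2_face_mul => //; exact: peval_L2_face.
    - by apply: L2_face_mul => //; exact: peval_L2_face.
    by apply: eq_Rintegral => s _; rewrite mE mulrBr.
  have EN : tet_int (fun x => u x * peval (- z j) x) = - tet_int (fun x => u x * peval (z j) x).
    rewrite -[RHS]mulN1r -tet_intZ; last by apply: L2_tet_mul => //; exact: peval_L2_tet.
    by apply: eq_tet_int => x; rewrite pevalN mulrN mulN1r.
  move: E; rewrite EN.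
  move: (ref_face_int Fp _) (ref_face_int Fp _) (ref_face_int Fm _) (tet_int _) (tet_int _).
  by move=> r1 r2 r3 r4 r5; lra.
have m0 : ref_face_int Fp (fun x => peval m x ^+ 2) = 0.
  have := H0 m md dm; rewrite (pairE _ _ _ (green_data_peval m)) dm.
  rewrite [X in _ + X](_ : _ = 0) ?addr0; last first.
    rewrite (@eq_tet_int _ _ (cst 0)); last by move=> x; rewrite peval0 mul0r.
    by rewrite /tet_int /Rintegral integral0.
  by move=> <-; apply: eq_Rintegral => s _; rewrite expr2.
exists (L2norm (peval zeta)); first exact: L2norm_ge0.
move=> u g tr; have G := green_data_H1 tr; rewrite (pairE _ _ _ G).
have [_ ldu lg _] := G.
have -> : ref_face_int Fp (fun x => g Fp x * peval m x) = 0.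
  apply/eqP; rewrite -normr_le0.
  apply: (le_trans (ref_face_int_mul_le (lg Fp) (peval_L2_face Fp m))).
  by rewrite m0 sqrtr0 mulr0.
rewrite add0r mulrC; apply: tet_int_mul_le => //; exact: peval_L2_tet.
Qed.

End Pairing.

(** * Unisolvence *)

Section Positivity.
Context (R : realType).
Notation mR := (measurableTypeR R).
Notation lam := (@lebesgue_measure R).
Implicit Types (p q r z : poly3 R) (i j : 'I_3) (F : 'I_4).

Lemma Rintegral_gt0 d (T : measurableType d) (mu : {measure set T -> \bar R})
    (D B : set T) (f : T -> R) (e : R) :
  measurable D -> measurable B -> B `<=` D -> mu.-integrable D (EFin \o f) ->
  (forall x, D x -> 0 <= f x) -> 0 < e -> (forall x, B x -> e <= f x) ->
  (0 < mu B)%E -> 0 < \int[mu]_(x in D) f x.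
Proof.
move=> mD mB BD fi f0 e0 fe B0.
have mf : measurable_fun D (EFin \o f) by exact: measurable_int fi.
rewrite /Rintegral fine_gt0//; apply/andP; split; last first.
  by move/integrable_lty : (fi) => /(_ mD).
apply: (@lt_le_trans _ _ (\int[mu]_(x in B) e%:E)%E).
  by rewrite integral_cst// mule_gt0.
apply: (@le_trans _ _ (\int[mu]_(x in B) (f x)%:E)%E).
  apply: ge0_le_integral => //.
  - by move=> x _; rewrite lee_fin ltW.
  - by apply: measurable_funS mf.
by apply: ge0_subset_integral => // x Dx; rewrite lee_fin; exact: f0.
Qed.

Let box1 (x e : R) : set mR := `]x - e, x + e[%classic.

Let box1_gt0 (x e : R) : 0 < e -> (0 < lam (box1 x e))%E.
Proof.
by move=> e0; rewrite /box1 lebesgue_measure_itv /= lte_fin ifT -?EFinB ?lte_fin; lra.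
Qed.

Let ball_box (x e y : R) : box1 x e y -> ball x e y.
Proof. by rewrite /box1 /= in_itv /= /ball /= ltr_distlC. Qed.

Lemma leb2_box (x : R * R) (e : R) : 0 < e -> exists B : set (mR * mR),
  [/\ measurable B, (0 < leb2 R B)%E & forall y, B y -> ball x e y].
Proof.
move=> e0; exists (box1 x.1 e `*` box1 x.2 e); split.
- by apply: measurableX; exact: measurable_itv.
- rewrite (_ : leb2 R _ = lam (box1 x.1 e) * lam (box1 x.2 e))%E.
    by rewrite mule_gt0 ?box1_gt0.
  by apply: product_measure1E; exact: measurable_itv.
- by move=> y [/= y1 y2]; split; exact: ball_box.
Qed.

Lemma leb3_box (x : R3 R) (e : R) : 0 < e -> exists B : set (mR * mR * mR),
  [/\ measurable B, (0 < leb3 R B)%E & forall y, B y -> ball x e y].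
Proof.
move=> e0; have [B [mB B0 BE]] := leb2_box x.1 e0.
exists (B `*` box1 x.2 e); split.
- by apply: measurableX => //; exact: measurable_itv.
- rewrite (_ : leb3 R _ = leb2 R B * lam (box1 x.2 e))%E.
    by rewrite mule_gt0 ?box1_gt0.
  by apply: product_measure1E => //; exact: measurable_itv.
- by move=> y [/= y1 y2]; split; [exact: BE|exact: ball_box].
Qed.

Lemma open_gt0_set (T : topologicalType) (f : T -> R) : continuous f ->
  open [set x | 0 < f x].
Proof.
move=> cf; have -> : [set x | 0 < f x] = f @^-1` [set y | 0 < y] by [].
by apply: open_comp => [x _|]; [exact: cf|exact: open_gt].
Qed.

Definition ref_tri_in : set (R * R) := [set s | [/\ 0 < s.1, 0 < s.2 & s.1 + s.2 < 1]].

Lemma open_ref_tri_in : open ref_tri_in.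
Proof.
have -> : ref_tri_in = [set s | 0 < s.1] `&` [set s | 0 < s.2] `&` [set s | 0 < 1 - (s.1 + s.2)].
  apply/seteqP; split => s /=; first by move=> [h1 h2 h3]; rewrite subr_gt0.
  by move=> [[h1 h2] h3]; split => //; rewrite -subr_gt0.
apply: openI; first apply: openI; apply: open_gt0_set => s.
- exact: cvg_fst.
- exact: cvg_snd.
- apply: cvgB; first exact: cvg_cst.
  by apply: cvgD; [exact: cvg_fst|exact: cvg_snd].
Qed.

Definition tet_in : set (R3 R) :=
  [set x | [/\ 0 < x.1.1, x.1.1 < x.1.2, 0 < x.2 & x.1.2 + x.2 < 1]].

Lemma tet_inE x : tet_in x <-> [/\ 0 < peval (PX R 0) x, 0 < peval (PX R 1 - PX R 0) x,
  0 < peval (PX R 2) x & 0 < peval (1 - PX R 1 - PX R 2) x].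
Proof.
rewrite !pevalB !peval_PX -mpolyC1 pevalC; have [-> -> ->] := coord3E x.
by split=> -[/= h1 h2 h3 h4]; split=> /=; lra.
Qed.

Lemma open_tet_in : open tet_in.
Proof.
have -> : tet_in = [set x | 0 < peval (PX R 0) x] `&` [set x | 0 < peval (PX R 1 - PX R 0) x]
    `&` [set x | 0 < peval (PX R 2) x] `&` [set x | 0 < peval (1 - PX R 1 - PX R 2) x].
  by apply/seteqP; split => x; [move=> /tet_inE[]|move=> [[[? ?] ?] ?]; apply/tet_inE].
by do 3?apply: openI; apply: open_gt0_set; exact: continuous_peval.
Qed.

Lemma tet_in_neq0 : tet_in !=set0.
Proof. by exists (1/4, 1/2, 1/4); split=> /=; lra. Qed.

(** A positive value at an interior point would keep [f] above half of it on a box of positive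
    measure. *)
Lemma tet_int_eq0 (f : R3 R -> R) : continuous f -> (forall x, tet x -> 0 <= f x) ->
  tet_int f = 0 -> forall x, tet_in x -> f x = 0.
Proof.
move=> cf f0 I0 x Tx; apply/eqP; apply: contraT => fx.
have tetx y : tet_in y -> tet y by move=> [h1 h2 h3 h4]; apply/tetP; split; exact: ltW.
have fx0 : 0 < f x by rewrite lt_neqAle eq_sym fx f0//; exact: tetx.
have : nbhs x (tet_in `&` [set y | 0 < f y - f x / 2]).
  apply: open_nbhs_nbhs; split; last by split => //=; lra.
  apply: openI; first exact: open_tet_in.
  by apply: open_gt0_set => y; apply: cvgB; [exact: cf|exact: cvg_cst].
move=> /nbhs_ballP[e /= e0 He].
have [B [mB B0 BE]] := leb3_box x e0.
suff : 0 < tet_int f by rewrite I0 ltxx.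
apply: (@Rintegral_gt0 _ _ (leb3 R) _ B f (f x / 2)) => //.
- exact: measurable_tet.
- by move=> y /BE/He[/tetx].
- exact: integrable_tet.
- by rewrite divr_gt0.
- by move=> y /BE/He[_ /=]; rewrite subr_gt0 => /ltW.
Qed.

Lemma ref_face_int_eq0 F p : ref_face_int F (fun x => peval p x ^+ 2) = 0 ->
  forall s, ref_tri_in s -> peval p (face_par F s) = 0.
Proof.
move=> I0 s Ts; apply/eqP; apply: contraT => ps.
pose f s := peval p (face_par F s) ^+ 2.
have cf : continuous f.
  move=> t; apply: (@continuous_comp _ _ _ (fun t => peval p (face_par F t)) (fun y => y ^+ 2)).
    exact: (continuous_face (F := F) (@continuous_peval R p)).
  exact: exprn_continuous.
have tris t : ref_tri_in t -> ref_tri t by move=> [h1 h2 h3]; split; exact: ltW.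
have fs0 : 0 < f s by rewrite /f exprn_even_gt0.
have : nbhs s (ref_tri_in `&` [set t | 0 < f t - f s / 2]).
  apply: open_nbhs_nbhs; split; last by split => //=; lra.
  apply: openI; first exact: open_ref_tri_in.
  by apply: open_gt0_set => y; apply: cvgB; [exact: cf|exact: cvg_cst].
move=> /nbhs_ballP[e /= e0 He].
have [B [mB B0 BE]] := leb2_box s e0.
suff : 0 < ref_face_int F (fun x => peval p x ^+ 2) by rewrite I0 ltxx.
apply: (@Rintegral_gt0 _ _ (leb2 R) _ B f (f s / 2)) => //.
- exact: measurable_ref_tri.
- by move=> y /BE/He[/tris].
- exact: integrable_ref_tri.
- by move=> y _; exact: sqr_ge0.
- by rewrite divr_gt0.
- by move=> y /BE/He[_ /=]; rewrite subr_gt0 => /ltW.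
Qed.

Lemma tet_int_sqr_eq0 p : tet_int (fun x => peval p x * peval p x) = 0 -> p = 0.
Proof.
move=> I0; apply: (peval_open_eq0 open_tet_in tet_in_neq0) => x Tx.
have := tet_int_eq0 _ _ I0 Tx; rewrite -expr2 => H; apply/eqP; rewrite -sqrf_eq0.
apply/eqP; apply: H => [|y _]; last by rewrite -expr2 sqr_ge0.
by apply: continuousM_fun; exact: continuous_peval.
Qed.

(** The restriction of [q] to the face, extended constantly along [e_j], is [subst j a q]. It
    vanishes on the open cylinder over the interior of the face, hence identically, and the factor
    theorem applies. The polynomials [s1] and [s2] recover the face parameters of a point of the
    cylinder, and [x0] witnesses that the cylinder is not empty. *)
Lemma face_factor j F (a s1 s2 q : poly3 R) (x0 : R3 R) d :
  (msize a <= 2)%N ->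
  (forall x i, coord3 (face_par F (peval s1 x, peval s2 x)) i =
               if i == j then peval a x else coord3 x i) ->
  ref_tri_in (peval s1 x0, peval s2 x0) ->
  (forall s, ref_tri_in s -> peval q (face_par F s) = 0) ->
  (msize q <= d.+1)%N ->
  exists2 r, (msize r <= d)%N & q = (PX R j - a) * r.
Proof.
move=> a2 sE s0 q0 qd; have [r rd E] := subst_factor j a2 qd; exists r => //.
rewrite -E (_ : subst j a q = 0) ?subr0//.
pose U := [set x | ref_tri_in (peval s1 x, peval s2 x)].
apply: (@peval_open_eq0 R U).
- apply: (@open_comp _ _ (fun x => (peval s1 x, peval s2 x))); last exact: open_ref_tri_in.
  by move=> x _; apply: continuous_pair; exact: continuous_peval.
- by exists x0.
- by move=> x Ux; rewrite (peval_subst _ (sE x)) q0.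
Qed.

End Positivity.

(** * Fields on which all degrees of freedom vanish *)

Section Unisolvence.
Context (R : realType).
Implicit Types (p q r : poly3 R) (i j l : 'I_3) (F : 'I_4).

Lemma ref_face_int_zero F (f : R3 R -> R) : (forall x, f x = 0) -> ref_face_int F f = 0.
Proof.
move=> f0; rewrite /ref_face_int (@eq_Rintegral _ _ _ _ _ (cst 0)) => [|s _].
  by rewrite /Rintegral integral0.
exact: f0.
Qed.

Lemma tet_int_zero (f : R3 R -> R) : (forall x, f x = 0) -> tet_int f = 0.
Proof. by move=> /(@eq_tet_int R f (cst 0)) ->; rewrite /tet_int /Rintegral integral0. Qed.

(** For [k = 1] there are no interior moments; forcing [z] to vanish lets both cases share the same
    pairing. *)
Definition interior_data (k : nat) (z : 'I_3 -> poly3 R) : Prop :=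
  if (2 <= k)%N then polN k.-1 z else forall j, z j = 0.

Definition poly_pair (w : 'I_3 -> poly3 R) (zF : 'I_4 -> poly3 R) (z : 'I_3 -> poly3 R) : R :=
  \sum_(j < 3) pair j (peval (w j)) (fun=> peval (w j)) zF z.

Section Kernel.
Variables (k : nat) (w : 'I_3 -> poly3 R).
Hypothesis k1 : (1 <= k)%N.
Hypothesis wk : forall j, polP k (w j).
Hypothesis w0 : forall zF z, (forall F, polP k (zF F)) -> interior_data k z ->
  poly_pair w zF z = 0.

Let k0 : k = k.-1.+1. Proof. by rewrite prednK. Qed.

Lemma interior_data0 : interior_data k (fun=> 0).
Proof.
rewrite /interior_data; case: ifP => // _; exists (fun=> 0), (fun=> 0); split.
- by move=> i; rewrite /polP msize0.
- by split=> [i|]; [rewrite /polP msize0|rewrite big1// => i _; rewrite mul0r].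
- by move=> i; rewrite addr0.
Qed.

Lemma kernel_faces zF : (forall F, polP k (zF F)) ->
  \sum_(F < 4) ref_face_int F (fun x =>
    (\sum_(j < 3) area_normal R F j * peval (w j) x) * peval (zF F) x) = 0.
Proof.
move=> zk; rewrite -[RHS](w0 zk interior_data0) /poly_pair /pair big_split /=.
rewrite [X in _ + X]big1 ?addr0; last first.
  by move=> j _; apply: tet_int_zero => x; rewrite peval0 mulr0.
rewrite [RHS]exchange_big /=; apply: eq_bigr => F _.
have ci j : face_integrable F (fun x => peval (w j) x * peval (zF F) x).
  by apply: L2_face_mul; exact: peval_L2_face.
have cai j : face_integrable F (fun x => area_normal R F j * (peval (w j) x * peval (zF F) x)).
  exact: (integrableZl (@measurable_ref_tri R) _ (ci j)).
rewrite sum_ord3 -!ref_face_intZ// -!ref_face_intD//; last first.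
  exact: (integrableD (@measurable_ref_tri R) (cai 0) (cai 1)).
by apply: eq_Rintegral => s _; rewrite sum_ord3 !mulrDl !mulrA.
Qed.

Lemma kernel_interior z : interior_data k z ->
  \sum_(j < 3) tet_int (fun x => peval (w j) x * peval (z j) x) = 0.
Proof.
move=> zk; have z0 F : polP k (0 : poly3 R) by rewrite /polP msize0.
rewrite -[RHS](w0 (zF := fun=> 0) z0 zk) /poly_pair /pair.
apply: eq_bigr => j _; rewrite big1 ?add0r// => F _.
by rewrite ref_face_int_zero ?mulr0// => x; rewrite peval0 mulr0.
Qed.

(** The normal component on [F] has degree at most [k], so it is admissible data on [F], with zero
    data on the other faces, and the integral of its square vanishes. *)
Lemma kernel_normal F : forall s, ref_tri_in s ->
  peval (\sum_(j < 3) area_normal R F j *: w j) (face_par F s) = 0.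
Proof.
apply: ref_face_int_eq0.
pose q := \sum_(j < 3) area_normal R F j *: w j.
have qk : polP k q.
  by apply: msize_sum_leq => j _; exact: leq_trans (msizeZ_le _ _) (wk j).
pose zF F' := if F' == F then q else 0.
have zk F' : polP k (zF F') by rewrite /zF; case: ifP; rewrite // /polP msize0.
rewrite -[RHS](kernel_faces zk) (bigD1 F)//= [X in _ + X]big1 ?addr0.
  apply: eq_Rintegral => s _; rewrite /zF eqxx expr2; congr (_ * _).
  by rewrite /q peval_sum; apply: eq_bigr => j _; rewrite pevalZ.
move=> F' F'F; rewrite /zF (negbTE F'F).
by apply: ref_face_int_zero => x; rewrite peval0 mulr0.
Qed.

Let dv := \sum_(j < 3) mderiv j (w j).

(** The divergence theorem for the field [q w]: its boundary term is the degree of freedom with data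
    [q] on every face. *)
Lemma kernel_green q : polP k q ->
  tet_int (fun x => peval dv x * peval q x) +
  \sum_(j < 3) tet_int (fun x => peval (w j) x * peval (mderiv j q) x) = 0.
Proof.
move=> qk; rewrite -[RHS](@kernel_faces (fun=> q))//.
have il j p p' : tet_integrable (fun x => peval p x * peval p' x).
  by apply: L2_tet_mul; exact: peval_L2_tet.
rewrite (_ : tet_int _ = \sum_(j < 3) tet_int (fun x => peval (mderiv j (w j)) x * peval q x)).
  rewrite -big_split /= (eq_bigr _ (fun j _ => esym (green_ibp j q (green_data_peval (w j))))).
  rewrite exchange_big /=; apply: eq_bigr => F _.
  have ci j : face_integrable F (fun x => peval (w j) x * peval q x).
    by apply: L2_face_mul; exact: peval_L2_face.
  have cai j : face_integrable F (fun x => area_normal R F j * (peval (w j) x * peval q x)).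
    exact: (integrableZl (@measurable_ref_tri R) _ (ci j)).
  rewrite sum_ord3 -!ref_face_intZ// -!ref_face_intD//; last first.
    exact: (integrableD (@measurable_ref_tri R) (cai 0) (cai 1)).
  by apply: eq_Rintegral => s _; rewrite sum_ord3 !mulrDl !mulrA.
rewrite -(tet_int_sum _ (fun j => il j (mderiv j (w j)) q)).2.
by apply: eq_tet_int => x; rewrite /dv peval_sum mulr_suml.
Qed.

(** Here [q] has degree at most [k - 1], so its gradient lies in the summand [P_{k-2}^3] of
    [N_{k-1}], or is zero when [k = 1]. *)
Lemma interior_data_grad q : (msize q <= k)%N -> interior_data k (fun j => mderiv j q).
Proof.
move=> qk; rewrite /interior_data; case: ifPn => [k2|].
  exists (fun j => mderiv j q), (fun=> 0); split.
  - move=> i; rewrite /polP (prednK (n := k.-1)); last by rewrite -ltnS -k0.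
    by apply: msize_mderiv; rewrite -k0.
  - by split=> [i|]; [rewrite /polP msize0|rewrite big1// => i _; rewrite mul0r].
  - by move=> i; rewrite addr0.
rewrite -ltnNge ltnS => k2 j; have k1' : k = 1%N by apply/eqP; rewrite eqn_leq k2 k1.
by move: qk; rewrite k1' => /msize1_polyC ->; rewrite mderivC.
Qed.

(** For [q] equal to the divergence, the gradient term in [kernel_green] is an interior moment; what
    remains is the integral of a square. *)
Lemma kernel_div : dv = 0.
Proof.
have dk : (msize dv <= k)%N.
  apply: msize_sum_leq => j _; exact: msize_mderiv (wk j).
apply: tet_int_sqr_eq0; rewrite -[LHS]addr0.
rewrite -[X in _ + X](kernel_interior (interior_data_grad dk)).
by apply: kernel_green; exact: leqW.
Qed.

(** The vanishing divergence allows potentials of degree [k], one more than [interior_data_grad]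
    does. The Euler potential of a field of degree [k - 1] requires exactly this. *)
Lemma kernel_grad q : polP k q ->
  \sum_(j < 3) tet_int (fun x => peval (w j) x * peval (mderiv j q) x) = 0.
Proof.
move=> qk; rewrite -[RHS](kernel_green qk) kernel_div [X in X + _](_ : _ = 0) ?add0r//.
by apply: tet_int_zero => x; rewrite peval0 mul0r.
Qed.

Lemma interior_data_orthogonal (s : 'I_3 -> poly3 R) :
  (forall j, (msize (s j) <= k)%N) -> \sum_(i < 3) s i * PX R i = 0 -> interior_data k s.
Proof.
move=> sk s0; rewrite /interior_data; case: ifPn => [k2|].
  exists (fun=> 0), s; split.
  - by move=> i; rewrite /polP msize0.
  - by split=> // i; rewrite /polP -k0.
  - by move=> i; rewrite add0r.
(* For [k = 1] the field is constant, and its product with [x] evaluated at [e_j] is its component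
   [j]. *)
rewrite -ltnNge ltnS => k2; have k1' : k = 1%N by apply/eqP; rewrite eqn_leq k2 k1.
have sC i : s i = mpolyC 3 (mcoeff mnm0 (s i)) by have := sk i; rewrite k1' => /msize1_polyC.
move=> j; rewrite sC; have /(congr1 (fun p => peval p (unit_vec R j))) := s0.
rewrite peval_sum peval0 (bigD1 j)//= pevalM peval_PX coord3_unit_vec eqxx mulr1.
rewrite big1 ?addr0; first by rewrite {1}sC pevalC => ->; rewrite mpolyC0.
by move=> i /negbTE; rewrite eq_sym pevalM peval_PX coord3_unit_vec => ->; rewrite mulr0.
Qed.

(** Euler's identity splits [z] into the gradient of a potential of degree [k] and a field
    orthogonal to [x], which is interior data. *)
Lemma kernel_orthogonal (z : 'I_3 -> poly3 R) : (forall j, (msize (z j) <= k)%N) ->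
  \sum_(j < 3) tet_int (fun x => peval (w j) x * peval (z j) x) = 0.
Proof.
move=> zk; have [|q qk Q0] := @euler_decomposition R k.-1 z; first by rewrite -k0.
rewrite -k0 in qk.
have sk j : (msize (z j - mderiv j q) <= k)%N.
  by apply: msizeB_leq => //; exact: msize_mderiv.
rewrite -[RHS](addr0 (0 : R)) -[X in _ = X + _](kernel_interior (interior_data_orthogonal sk Q0)).
rewrite -[X in _ = _ + X](kernel_grad qk) -big_split /=.
apply: eq_bigr => j _; rewrite -tet_intD; last 2 first.
- by apply: L2_tet_mul; exact: peval_L2_tet.
- by apply: L2_tet_mul; exact: peval_L2_tet.
by apply: eq_tet_int => x; rewrite -mulrDr -pevalD subrK.
Qed.

(* The field [w] is orthogonal to [P_{k-1}^3], and [w 0], [w 1 - w 0] and [w 2]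
   are divisible by the barycentric coordinates [x_1], [x_2 - x_1] and [x_3];
   testing with the quotients turns the orthogonality into a vanishing sum of
   weighted squares. *)
Lemma bdm_unisolvent j : w j = 0.
Proof.
have N1 s : ref_tri_in s -> peval (w 0) (face_par 1 s) = 0.
  move=> /(@kernel_normal 1).
  by rewrite sum_ord3 /area_normal /= !scale0r !addr0 scaleN1r pevalN => /eqP; rewrite oppr_eq0 => /eqP.
have N2 s : ref_tri_in s -> peval (w 1 - w 0) (face_par 2 s) = 0.
  move=> /(@kernel_normal 2).
  rewrite sum_ord3 /area_normal /= scale1r scale0r addr0 scaleN1r -opprB pevalN.
  by move=> /eqP; rewrite oppr_eq0 => /eqP.
have N3 s : ref_tri_in s -> peval (w 2) (face_par 3 s) = 0.
  move=> /(@kernel_normal 3).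
  by rewrite sum_ord3 /area_normal /= !scale0r !add0r scaleN1r pevalN => /eqP; rewrite oppr_eq0 => /eqP.
have m0 : (msize (0 : poly3 R) <= 2)%N by rewrite msize0.
have [r0 r0k E0] : exists2 r, (msize r <= k)%N & w 0 = (PX R 0 - 0) * r.
  apply: (@face_factor R 0 1 0 (PX R 1) (PX R 2) (w 0) (0, 1/4, 1/4)) => //.
  - move=> x i; have [_ -> _ _] := face_parE (peval (PX R 1) x, peval (PX R 2) x).
    rewrite !peval_PX peval0; have [e1 e2 e3] := coord3E (0, coord3 x 1, coord3 x 2).
    by move: i; apply: forall_ord3.
  - by rewrite !peval_PX; have [_ -> ->] := coord3E ((0, 1/4, 1/4) : R3 R); split=> /=; lra.
  - exact: wk.
have [r1 r1k E1] : exists2 r, (msize r <= k)%N & w 1 - w 0 = (PX R 1 - PX R 0) * r.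
  apply: (@face_factor R 1 2 (PX R 0) (PX R 0) (PX R 2) (w 1 - w 0) (1/4, 0, 1/4)) => //.
  - by rewrite msize_PX.
  - move=> x i; have [_ _ -> _] := face_parE (peval (PX R 0) x, peval (PX R 2) x).
    rewrite !peval_PX; have [e1 e2 e3] := coord3E (coord3 x 0, coord3 x 0, coord3 x 2).
    by move: i; apply: forall_ord3.
  - by rewrite !peval_PX; have [-> _ ->] := coord3E ((1/4, 0, 1/4) : R3 R); split=> /=; lra.
  - by apply: msizeB_leq; exact: wk.
have [r2 r2k E2] : exists2 r, (msize r <= k)%N & w 2 = (PX R 2 - 0) * r.
  apply: (@face_factor R 2 3 0 (PX R 0) (PX R 1 - PX R 0) (w 2) (1/4, 1/2, 0)) => //.
  - move=> x i; have [_ _ _ ->] := face_parE (peval (PX R 0) x, peval (PX R 1 - PX R 0) x).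
    rewrite pevalB !peval_PX peval0 /= addrC subrK.
    have [e1 e2 e3] := coord3E (coord3 x 0, coord3 x 1, 0).
    by move: i; apply: forall_ord3.
  - rewrite pevalB !peval_PX; have [-> -> _] := coord3E ((1/4, 1/2, 0) : R3 R).
    by split=> /=; lra.
  - exact: wk.
move: E0 E2; rewrite !subr0 => E0 E2.
(* Writing [w 1 = (w 1 - w 0) + w 0], the term [- r1] in the first component cancels the cross term
   [w 0 * r1]. *)
pose z l := [tuple r0 - r1; r1; r2]`_l.
have zk l : (msize (z l) <= k)%N.
  by move: l; apply: forall_ord3 => //; exact: msizeB_leq.
pose f := PX R 0 * r0 * r0 + (PX R 1 - PX R 0) * r1 * r1 + PX R 2 * r2 * r2.
have fE : \sum_(l < 3) w l * z l = f.
  rewrite sum_ord3 /z /= -[w 1](subrK (w 0)) E1 E0 E2 /f.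
  move: (PX R 0) (PX R 1) (PX R 2) => a b c; ring.
have If : tet_int (peval f) = 0.
  rewrite -[RHS](kernel_orthogonal zk) -fE.
  have il l : tet_integrable (fun x => peval (w l) x * peval (z l) x).
    by apply: L2_tet_mul; exact: peval_L2_tet.
  rewrite -(tet_int_sum _ il).2; apply: eq_tet_int => x.
  by rewrite peval_sum; apply: eq_bigr => l _; rewrite pevalM.
have fxE x : peval f x = x.1.1 * peval r0 x ^+ 2 + (x.1.2 - x.1.1) * peval r1 x ^+ 2 +
    x.2 * peval r2 x ^+ 2.
  rewrite /f !pevalD !pevalM pevalB !peval_PX; have [-> -> ->] := coord3E x.
  by rewrite !expr2 !mulrA.
have f0 x : tet_in x -> [/\ peval r0 x = 0, peval r1 x = 0 & peval r2 x = 0].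
  move=> Tx; have := tet_int_eq0 (@continuous_peval R f) _ If Tx.
  have [h1 h2 h3 h4] := Tx.
  have {}h2 : 0 < x.1.2 - x.1.1 by rewrite subr_gt0.
  rewrite fxE => H; have {H} : x.1.1 * peval r0 x ^+ 2 +
      (x.1.2 - x.1.1) * peval r1 x ^+ 2 + x.2 * peval r2 x ^+ 2 = 0.
    apply: H => y /tetP[g1 g2 g3 g4]; rewrite fxE.
    by apply: addr_ge0; first apply: addr_ge0; apply: mulr_ge0; rewrite ?sqr_ge0 ?subr_ge0.
  have sqP (a b : R) : 0 < a -> 0 <= a * b ^+ 2 /\ (a * b ^+ 2 = 0 -> b = 0).
    move=> a0; split; first by rewrite mulr_ge0 ?sqr_ge0 ?ltW.
    by move/eqP; rewrite mulf_eq0 gt_eqF//= sqrf_eq0 => /eqP.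
  have [p0 q0] := sqP _ (peval r0 x) h1; have [p1 q1] := sqP _ (peval r1 x) h2.
  have [p2 q2] := sqP _ (peval r2 x) h3.
  by move=> H; split; [apply: q0|apply: q1|apply: q2]; lra.
have zero r : (forall x, tet_in x -> peval r x = 0) -> r = 0.
  exact: (peval_open_eq0 (@open_tet_in R) (@tet_in_neq0 R)).
have z0 : r0 = 0 by apply: zero => y /f0[].
have z1 : r1 = 0 by apply: zero => y /f0[].
have z2 : r2 = 0 by apply: zero => y /f0[].
have e0 : w 0 = 0 by rewrite E0 z0 mulr0.
have e1 : w 1 = 0 by move: E1; rewrite e0 subr0 z1 mulr0.
have e2 : w 2 = 0 by rewrite E2 z2 mulr0.
by move: j; apply: forall_ord3.
Qed.

End Kernel.
End Unisolvence.

(** * The estimate *)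

Section Duality.
Context (R : realType).

(** A subspace [L] of [R^I] with trivial annihilator is the whole space. A matrix of maximal rank
    with row space inside [L] turns the predicate into a row space; the columns of its cokernel
    annihilate [L], hence vanish, and the rank is full. *)
Lemma separating_functionals (I : finType) (L : (I -> R) -> Prop) :
  L (fun=> 0) -> (forall (a : R) l m, L l -> L m -> L (fun i => a * l i + m i)) ->
  (forall c, (forall l, L l -> \sum_i c i * l i = 0) -> forall i, c i = 0) ->
  forall i0, L (fun i => (i == i0)%:R).
Proof.
move=> L0 LD Lsep i0; set n := #|I|.
pose inL (A : 'M[R]_n) := forall v : 'rV_n, (v <= A)%MS -> L (fun i => v 0 (enum_rank i)).
pose P r := `[< exists2 A, inL A & \rank A = r >].
have exP : exists r, P r.
  exists 0%N; apply/asboolP; exists 0; last exact: mxrank0.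
  move=> v; rewrite submx0 => /eqP ->.
  by rewrite (_ : (fun i => _) = (fun=> 0))//; apply/funext => i; rewrite mxE.
have ubP r : P r -> (r <= n)%N by move=> /asboolP[A _ <-]; exact: rank_leq_row.
case: (ex_maxnP exP ubP) => r /asboolP[A AL rA] rmax.
have vec (l : I -> R) : L l -> ((\row_k l (enum_val k)) <= A)%MS.
  move=> Ll; set v := \row_k _.
  (* A vector of [L] outside the row space could be added to [A], against the maximality of the
     rank. *)
  suff : (A + v <= A)%MS by rewrite addsmx_sub => /andP[].
  have AAv : (A <= A + v)%MS by exact: addsmxSl.
  rewrite -(geq_leqif (mxrank_leqif_sup AAv)) rA.
  apply: rmax; apply/asboolP; exists (A + v)%MS => // u /sub_addsmxP[[x y] /= ->].
  rewrite (_ : (fun i => _) = (fun i => y 0 0 * l i + (x *m A) 0 (enum_rank i))).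
    by apply: LD => //; apply: AL; exact: submxMl.
  apply/funext => i; rewrite mxE addrC; congr (_ + _).
  by rewrite mxE big_ord1 mxE enum_rankK.
have Afull : row_full A.
  rewrite -cokermx_eq0; apply/eqP/matrixP => k j; rewrite [RHS]mxE.
  rewrite -[k]enum_valK; apply: (Lsep (fun i => cokermx A (enum_rank i) j)) => l Ll.
  have /submxP[x xE] := vec l Ll.
  have /matrixP/(_ 0 j) : (\row_k l (enum_val k)) *m cokermx A = 0.
    by rewrite xE -mulmxA mulmx_coker mulmx0.
  rewrite !mxE => E; rewrite -[RHS]E (reindex (@enum_val I (mem I))) /=; last first.
    by exists enum_rank => i _; rewrite ?enum_valK ?enum_rankK.
  by apply: eq_bigr => i _; rewrite mxE enum_valK mulrC.
rewrite (_ : (fun i => _) = (fun i => (delta_mx 0 (enum_rank i0) : 'rV[R]_n) 0 (enum_rank i))).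
  by apply: AL; exact: submx_full.
by apply/funext => i; rewrite mxE eqxx /= (inj_eq enum_rank_inj).
Qed.

End Duality.

(** * From the coefficients of the interpolant to its norm *)

Section MainEstimate.
Context (R : realType).
Implicit Types (p q : poly3 R) (i j l : 'I_3) (F : 'I_4).

Lemma pair_lin_data j (u : R3 R -> R) g (a : R) zF zF' z z' :
  L2_tet u -> (forall F, L2_face F (g F)) ->
  pair j u g (fun F => a *: zF F + zF' F) (fun j => a *: z j + z' j) =
  a * pair j u g zF z + pair j u g zF' z'.
Proof.
move=> lu lg; rewrite /pair mulrDr addrACA mulr_sumr -big_split /=; congr (_ + _).
  apply: eq_bigr => F _.
  have ci q : face_integrable F (fun x => g F x * peval q x).
    by apply: L2_face_mul => //; exact: peval_L2_face.
  have cai q : face_integrable F (fun x => a * (g F x * peval q x)).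
    exact: (integrableZl (@measurable_ref_tri R) _ (ci q)).
  rewrite mulrCA -mulrDr; congr (_ * _); rewrite -ref_face_intZ// -ref_face_intD//.
  by apply: eq_Rintegral => s _; rewrite pevalD pevalZ mulrDr mulrCA.
have ci q : tet_integrable (fun x => u x * peval q x).
  by apply: L2_tet_mul => //; exact: peval_L2_tet.
rewrite -tet_intZ// -tet_intD//; last exact: tet_integrableZ.
by apply: eq_tet_int => x; rewrite pevalD pevalZ mulrDr mulrCA.
Qed.

Definition ppair j p (zF : 'I_4 -> poly3 R) z : R := pair j (peval p) (fun=> peval p) zF z.

Lemma ppair_lin j a p q zF z :
  ppair j (a *: p + q) zF z = a * ppair j p zF z + ppair j q zF z.
Proof.
rewrite /ppair /pair mulrDr addrACA mulr_sumr -big_split /=; congr (_ + _).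
  apply: eq_bigr => F _.
  have ci r : face_integrable F (fun x => peval r x * peval (zF F) x).
    by apply: L2_face_mul; exact: peval_L2_face.
  have cai r : face_integrable F (fun x => a * (peval r x * peval (zF F) x)).
    exact: (integrableZl (@measurable_ref_tri R) _ (ci r)).
  rewrite mulrCA -mulrDr; congr (_ * _); rewrite -ref_face_intZ// -ref_face_intD//.
  by apply: eq_Rintegral => s _; rewrite pevalD pevalZ mulrDl mulrA.
have ci r : tet_integrable (fun x => peval r x * peval (z j) x).
  by apply: L2_tet_mul; exact: peval_L2_tet.
rewrite -tet_intZ// -tet_intD//; last exact: tet_integrableZ.
by apply: eq_tet_int => x; rewrite pevalD pevalZ mulrDl mulrA.
Qed.

Lemma ppair0 j zF z : ppair j 0 zF z = 0.
Proof.
have := ppair_lin j (-1) 0 0 zF z.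
by rewrite scaler0 addr0 mulN1r addNr.
Qed.

Lemma ppair_sum j (I : Type) (s : seq I) (c : I -> R) (P : I -> poly3 R) zF z :
  ppair j (\sum_(k <- s) c k *: P k) zF z = \sum_(k <- s) c k * ppair j (P k) zF z.
Proof.
elim: s => [|k s IH]; first by rewrite !big_nil ppair0.
by rewrite !big_cons ppair_lin IH.
Qed.

Lemma interior_data_lin k (a : R) z z' : interior_data k z -> interior_data k z' ->
  interior_data k (fun j => a *: z j + z' j).
Proof.
rewrite /interior_data; case: ifP => _; last by move=> h h' j; rewrite h h' scaler0 addr0.
move=> [p [q [pd [qd q0] zE]]] [p' [q' [pd' [qd' q0'] zE']]].
have mD e (f f' : poly3 R) : (msize f <= e)%N -> (msize f' <= e)%N -> (msize (a *: f + f') <= e)%N.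
  by move=> fe fe'; apply: msizeD_leq => //; exact: leq_trans (msizeZ_le _ _) fe.
exists (fun j => a *: p j + p' j), (fun j => a *: q j + q' j); split.
- by move=> i; apply: mD; [exact: pd|exact: pd'].
- split; first by move=> i; apply: mD; [exact: qd|exact: qd'].
  under eq_bigr do rewrite mulrDl -scalerAl.
  by rewrite big_split /= -scaler_sumr q0 q0' scaler0 addr0.
- by move=> i; rewrite zE zE' scalerDr addrACA.
Qed.

Lemma interior_data_msize k (z : 'I_3 -> poly3 R) : (1 <= k)%N -> interior_data k z ->
  forall j, (msize (z j) <= k)%N.
Proof.
move=> k1; rewrite /interior_data; case: ifPn => [k2|_ z0 j]; last by rewrite z0 msize0.
move=> [p [q [pd [qd _] zE]]] j; rewrite zE; apply: msizeD_leq.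
  apply: (leq_trans (pd j)); rewrite prednK ?leq_pred//.
  by case: (k) k2 => [|[]].
by apply: (leq_trans (qd j)); rewrite prednK.
Qed.

Lemma mcoeff_bsum k (c : bmultinom 3 k -> R) (m' : bmultinom 3 k) :
  mcoeff m' (\sum_(m : bmultinom 3 k) c m *: mpolyX R m) = c m'.
Proof.
rewrite raddf_sum /= (bigD1 m')//= mcoeffZ mcoeffX eqxx mulr1 big1 ?addr0// => m mm'.
by rewrite mcoeffZ mcoeffX -bmeqP (negbTE mm') mulr0.
Qed.

(** A degree of freedom is recorded by its values on the monomial fields of degree at most [k]. A
    relation [c] satisfied by all these records is the list of coefficients of a field on which all
    degrees of freedom vanish, so [c] is zero by unisolvence, and every coordinate function is a
    record. *)
Lemma coefficient_dof (k : nat) i (m : bmultinom 3 k.+1) : (1 <= k)%N ->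
  exists zF z, [/\ forall F, polP k (zF F), interior_data k z &
    forall j p, polP k p -> ppair j p zF z = if j == i then mcoeff m p else 0].
Proof.
move=> k1; pose I : finType := ('I_3 * bmultinom 3 k.+1)%type.
pose L (l : I -> R) := exists zF z, [/\ forall F, polP k (zF F), interior_data k z &
  forall jm : I, l jm = ppair jm.1 (mpolyX R jm.2) zF z].
have L0 : L (fun=> 0).
  exists (fun=> 0), (fun=> 0); split => [F||jm].
  - by rewrite /polP msize0.
  - exact: interior_data0.
  (* Linearity with the factor -1 at zero data gives the value in the form [- x + x]. *)
  - have := @pair_lin_data jm.1 (peval (mpolyX R jm.2)) (fun=> peval (mpolyX R jm.2)) (-1)
      (fun=> 0) (fun=> 0) (fun=> 0) (fun=> 0) (peval_L2_tet _) (fun F => peval_L2_face F _).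
    rewrite -/(ppair _ _ _ _) mulN1r addNr /ppair => <-.
    by congr pair; apply/funext => ?; rewrite scaler0 addr0.
have LD (a : R) (h h' : I -> R) : L h -> L h' -> L (fun x => a * h x + h' x).
  move=> [zF [z [zk zi lE]]] [zF' [z' [zk' zi' lE']]].
  exists (fun F => a *: zF F + zF' F), (fun j => a *: z j + z' j); split => [F||jm].
  - apply: msizeD_leq; last exact: zk'.
    exact: leq_trans (msizeZ_le _ _) (zk F).
  - exact: interior_data_lin.
  - rewrite lE lE' /ppair pair_lin_data//; first exact: peval_L2_tet.
    by move=> F; exact: peval_L2_face.
have polE (c : bmultinom 3 k.+1 -> R) : polP k (\sum_(m : bmultinom 3 k.+1) c m *: mpolyX R m).
  apply: msize_sum_leq => m' _; rewrite (leq_trans (msizeZ_le _ _))// msizeX.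
  exact: bmdeg.
have Lsep (c : I -> R) : (forall h, L h -> \sum_x c x * h x = 0) -> forall x, c x = 0.
  move=> cL; pose w j := \sum_(m : bmultinom 3 k.+1) c (j, m) *: mpolyX R m.
  have w0 zF z : (forall F, polP k (zF F)) -> interior_data k z -> poly_pair w zF z = 0.
    move=> zk zi; rewrite -[RHS](cL (fun jm => ppair jm.1 (mpolyX R jm.2) zF z)).
      transitivity (\sum_j \sum_(m' : bmultinom 3 k.+1)
          c (j, m') * ppair j (mpolyX R m') zF z).
        by apply: eq_bigr => j _; rewrite -[LHS]/(ppair j (w j) zF z) ppair_sum.
      by rewrite pair_bigA /=; apply: eq_bigr => -[j m'] _.
    by exists zF, z; split.
  move=> [j m']; have := bdm_unisolvent k1 (fun j => polE _) w0 j.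
  move=> /(congr1 (mcoeff m')); rewrite mcoeff0 => <-.
  by rewrite /w mcoeff_bsum.
have [zF [z [zk zi lE]]] := separating_functionals L0 LD Lsep (i, m).
exists zF, z; split=> // j p pk.
rewrite {1}(mpolywE pk) ppair_sum (bigD1 m)//= -(lE (j, m)) xpair_eqE eqxx andbT.
rewrite big1 ?addr0.
  by case: eqP => _; rewrite ?mulr1 ?mulr0.
by move=> m' mm'; rewrite -(lE (j, m')) xpair_eqE (negbTE mm') andbF mulr0.
Qed.

(** One factor of the squared norm is expanded in monomials, Cauchy-Schwarz is applied to each term,
    and the norm of [p] is divided out. *)
Lemma L2norm_peval_le k p : (msize p <= k)%N ->
  L2norm (peval p) <=
  \sum_(m : bmultinom 3 k) `|mcoeff m p| * L2norm (peval (mpolyX R m)).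
Proof.
move=> pk; have lp := peval_L2_tet p.
have N2 : L2norm (peval p) ^+ 2 = tet_int (fun x => peval p x * peval p x).
  rewrite (L2on_norm_sqr (@measurable_tet R) lp).
  by apply: eq_tet_int => x; rewrite expr2.
have H : L2norm (peval p) ^+ 2 <=
    (\sum_(m : bmultinom 3 k) `|mcoeff m p| * L2norm (peval (mpolyX R m))) * L2norm (peval p).
  rewrite N2; have ci (m : bmultinom 3 k) : tet_integrable (fun x => peval (mpolyX R m) x * peval p x).
    by apply: L2_tet_mul => //; exact: peval_L2_tet.
  have cai (m : bmultinom 3 k) : tet_integrable
      (fun x => mcoeff m p * (peval (mpolyX R m) x * peval p x)).
    exact: tet_integrableZ.
  rewrite (_ : tet_int _ = \sum_(m : bmultinom 3 k)
      mcoeff m p * tet_int (fun x => peval (mpolyX R m) x * peval p x)); last first.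
    under eq_bigr do rewrite -tet_intZ//.
    rewrite -(tet_int_sum _ cai).2; apply: eq_tet_int => x.
    rewrite [X in peval X x * _](mpolywE pk) peval_sum mulr_suml.
    by apply: eq_bigr => m _; rewrite pevalZ mulrA.
  rewrite mulr_suml ler_sum// => m _.
  rewrite (le_trans (ler_norm _))// normrM -mulrA ler_wpM2l//.
  exact: tet_int_mul_le (peval_L2_tet _) lp.
have [->|N0] := eqVneq (L2norm (peval p)) 0.
  by apply: sumr_ge0 => m _; rewrite mulr_ge0 ?L2norm_ge0.
have N1 : 0 < L2norm (peval p) by rewrite lt_neqAle eq_sym N0 L2norm_ge0.
by rewrite -(ler_pM2r N1) -expr2.
Qed.

Definition unit_normal F : R3 R :=
  (area_normal R F 0 / face_jac R F, area_normal R F 1 / face_jac R F,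
   area_normal R F 2 / face_jac R F).

Lemma coord3_unit_normal F j : coord3 (unit_normal F) j = area_normal R F j / face_jac R F.
Proof. by move: j; apply: forall_ord3; rewrite /coord3 (tnth_nth 0). Qed.

Lemma dot_unit_normal F y : dot (unit_normal F) y =
  (\sum_(j < 3) area_normal R F j * coord3 y j) / face_jac R F.
Proof.
by rewrite /dot mulr_suml; apply: eq_bigr => j _; rewrite coord3_unit_normal mulrAC.
Qed.

Lemma coord3B (x y : R3 R) j : coord3 (x - y) j = coord3 x j - coord3 y j.
Proof. by move: j; apply: forall_ord3; rewrite /coord3 !(tnth_nth 0). Qed.

(** The scalar product of the area normal of [F] with [x] is the affine function
    [(F == 0) - lambda_F], where [lambda_F] is the barycentric coordinate vanishing on [F] and equal
    to 1 at the opposite vertex. *)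
Lemma area_normal_face F j :
  \sum_(l < 3) area_normal R F l * coord3 (face_vtx R F j) l = (F == 0)%:R.
Proof.
rewrite sum_ord3 /face_vtx !coord3_vtx /area_normal.
by move: F; apply: forall_ord4; move: j; apply: forall_ord3 => /=; ring.
Qed.

Lemma area_normal_vtx F :
  \sum_(l < 3) area_normal R F l * coord3 (vtx R F) l = (F == 0)%:R - 1.
Proof.
rewrite sum_ord3 !coord3_vtx /area_normal.
by move: F; apply: forall_ord4 => /=; ring.
Qed.

(** The flux conditions in [is_BDM] range over the outward unit normals, so one has to be exhibited
    on each face before they yield anything. *)
Lemma outward_unit_normal_exists F : outward_unit_normal F (unit_normal F).
Proof.
have J0 := face_jac_gt0 R F; split.
- rewrite dot_unit_normal; under eq_bigr do rewrite coord3_unit_normal mulrA.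
  rewrite -mulr_suml -mulrA -invfM -expr2.
  have -> : \sum_(j < 3) area_normal R F j * area_normal R F j = face_jac R F ^+ 2.
    rewrite face_jacE sqr_sqrtr; last by move: F {J0}; apply: forall_ord4 => /=.
    by rewrite sum_ord3 /area_normal; move: F {J0}; apply: forall_ord4 => /=; ring.
  by rewrite divff// sqrf_eq0 gt_eqF.
- move=> j l; rewrite dot_unit_normal; under eq_bigr do rewrite coord3B mulrBr.
  by rewrite sumrB !area_normal_face subrr mul0r.
- move=> j; rewrite dot_unit_normal; under eq_bigr do rewrite coord3B mulrBr.
  rewrite sumrB area_normal_face area_normal_vtx addrAC subrr add0r mulN1r oppr_lt0.
  by rewrite invr_gt0.
Qed.

(** The Jacobian of the parametrisation turns the unit normal into the area normal. *)
Lemma face_flux F (v : 'I_3 -> R3 R -> R) p : (forall j, L2_face F (v j)) ->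
  face_int F (fun x => (\sum_(j < 3) v j x * coord3 (unit_normal F) j) * peval p x) =
  \sum_(j < 3) area_normal R F j * ref_face_int F (fun x => v j x * peval p x).
Proof.
move=> lv; have J0 := face_jac_gt0 R F.
have ci j : face_integrable F (fun x => v j x * peval p x).
  by apply: L2_face_mul => //; exact: peval_L2_face.
have cai j a : face_integrable F (fun x => a * (v j x * peval p x)).
  exact: (integrableZl (@measurable_ref_tri R) _ (ci j)).
transitivity (face_jac R F * \sum_(j < 3)
    ref_face_int F (fun x => area_normal R F j / face_jac R F * (v j x * peval p x))).
  congr (_ * _); rewrite sum_ord3 -!ref_face_intD//; last first.
    exact: (integrableD (@measurable_ref_tri R) (cai 0 _) (cai 1 _)).
  apply: eq_Rintegral => s _; rewrite sum_ord3 !coord3_unit_normal !mulrDl.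
  by congr (_ + _ + _); rewrite mulrAC mulrC.
rewrite mulr_sumr; apply: eq_bigr => j _; rewrite ref_face_intZ// mulrA.
by rewrite mulrCA divff ?mulr1// gt_eqF.
Qed.

Lemma bdm_pairing k (u : 'I_3 -> H1space R) w : is_BDM k u w ->
  exists2 g : 'I_4 -> 'I_3 -> R3 R -> R, (forall F j, is_trace F (u j) (g F j)) &
  forall zF z, (forall F, polP k (zF F)) -> interior_data k z ->
    poly_pair w zF z = \sum_(j < 3) pair j (u j) (g ^~ j) zF z.
Proof.
move=> [wk [g [tr Hf]] Hi]; exists g => // zF z zk zi.
rewrite /poly_pair /pair !big_split /=; congr (_ + _).
  rewrite exchange_big [RHS]exchange_big; apply: eq_bigr => F _ /=.
  rewrite -(face_flux (v := fun j => peval (w j))); last by move=> j; exact: peval_L2_face.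
  rewrite -(face_flux (v := g F)); last by move=> j; have [] := tr F j.
  exact: Hf (outward_unit_normal_exists F) (zk F).
move: zi; rewrite /interior_data; case: ifPn => [k2 zN|_ z0].
  have i1 j : tet_integrable (fun x => peval (w j) x * peval (z j) x).
    by apply: L2_tet_mul; exact: peval_L2_tet.
  have i2 j : tet_integrable (fun x => u j x * peval (z j) x).
    by apply: L2_tet_mul; [exact: H1val_L2|exact: peval_L2_tet].
  by rewrite -(tet_int_sum _ i1).2 -(tet_int_sum _ i2).2; exact: Hi.
by apply: eq_bigr => j _; rewrite !tet_int_zero// => x; rewrite z0 peval0 mulr0.
Qed.

Lemma bdm_coefficient_bound (k : nat) i (m : bmultinom 3 k.+1) : (1 <= k)%N ->
  exists2 C : R, 0 <= C & forall (u : 'I_3 -> H1space R) w, is_BDM k u w ->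
    `|mcoeff m (w i)| <= C * (H1norm (u i) + \sum_(j < 3 | j != i) L2norm (wpd (u j) j)).
Proof.
move=> k1; have [zF [z [zk zi E]]] := coefficient_dof i m k1.
have [Ci Ci0 HCi] := pair_H1_bound i zF z.
(* For [j = i] the bound is void and 0 serves as constant, so that a constant can be chosen for
   every [j]. *)
have Hj j : exists C : R, 0 <= C /\ (j != i -> forall (u : H1space R) g,
    (forall F, is_trace F u (g F)) -> `|pair j u g zF z| <= C * L2norm (wpd u j)).
  have [->|ji] := eqVneq j i; first by exists 0.
  have [||C C0 HC] := @pair_deriv_bound R j k zF z zk.
  - exact: interior_data_msize.
  - by move=> p pk _; have := E j p pk; rewrite (negbTE ji).
  by exists C.
have [Cj HCj] := choice Hj.
exists (Ci + \sum_(j < 3) Cj j).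
  by rewrite addr_ge0// sumr_ge0// => j _; have [] := HCj j.
move=> u w wu; have [g tr bE] := bdm_pairing wu; have [wk _ _] := wu.
have -> : mcoeff m (w i) = \sum_(j < 3) pair j (u j) (g ^~ j) zF z.
  rewrite -bE// /poly_pair (bigD1 i)//= big1 ?addr0 => [|j ji].
    by have := E i (w i) (wk i); rewrite eqxx.
  by have := E j (w j) (wk j); rewrite (negbTE ji).
have H1ge0 (v : H1space R) : 0 <= H1norm v by exact: sqrtr_ge0.
have S0 : 0 <= \sum_(j < 3) Cj j by apply: sumr_ge0 => j _; have [] := HCj j.
rewrite (bigD1 i)//= (le_trans (ler_normD _ _))// mulrDr lerD//.
  apply: (le_trans (HCi _ _ (tr ^~ i))).
  by rewrite ler_wpM2r// lerDl.
rewrite (le_trans (ler_norm_sum _ _ _))// mulr_sumr ler_sum// => j ji.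
apply: (le_trans ((HCj j).2 ji _ _ (tr ^~ j))).
rewrite ler_wpM2r ?L2norm_ge0// (bigD1 j)//= addrCA lerDl addr_ge0//.
by apply: sumr_ge0 => l _; have [] := HCj l.
Qed.

End MainEstimate.

Theorem lemma11 (R : realType) (k : nat) (hk : (1 <= k)%N) :
  exists2 C : R, 0 < C &
    forall (u : 'I_3 -> H1space R) (w : 'I_3 -> poly3 R),
      is_BDM k u w ->
      forall i : 'I_3,
        L2norm (peval (w i)) <=
        C * (H1norm (u i) + \sum_(j < 3 | j != i) L2norm (wpd (u j) j)).
Proof.
have /choice[c Hc] : forall im : 'I_3 * bmultinom 3 k.+1, exists C : R, 0 <= C /\
    forall (u : 'I_3 -> H1space R) w, is_BDM k u w ->
    `|mcoeff im.2 (w im.1)| <=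
      C * (H1norm (u im.1) + \sum_(j < 3 | j != im.1) L2norm (wpd (u j) j)).
  by move=> [i m]; have [C C0 HC] := bdm_coefficient_bound R i m hk; exists C.
pose b i (m : bmultinom 3 k.+1) := c (i, m) * L2norm (peval (mpolyX R m)).
have b0 i m : 0 <= b i m by rewrite mulr_ge0 ?L2norm_ge0//; have [] := Hc (i, m).
(* The summand 1 makes the constant positive, and the sum over [i] makes it common to the three
   components. *)
exists (1 + \sum_(i < 3) \sum_m b i m).
  by rewrite ltr_wpDr// !sumr_ge0// => i _; rewrite sumr_ge0.
move=> u w wu i; set N := H1norm _ + _.
have N0 : 0 <= N.
  by rewrite addr_ge0 ?sqrtr_ge0// sumr_ge0// => j _; exact: L2norm_ge0.
have [wk _ _] := wu.
apply: (le_trans (L2norm_peval_le (wk i))).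
apply: (@le_trans _ _ (\sum_m b i m * N)).
  apply: ler_sum => m _; rewrite /b mulrAC ler_wpM2r ?L2norm_ge0//.
  exact: (Hc (i, m)).2.
rewrite -mulr_suml ler_wpM2r// [X in _ <= 1 + X](bigD1 i)//= addrCA lerDl addr_ge0//.
by apply: sumr_ge0 => j _; apply: sumr_ge0.
Qed.
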